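(* Let $(\bar x,\bar\lambda)=(\bar x^1,\dots,\bar x^N,\bar\lambda^1,\dots,\bar\lambda^N)\in S_{\rm KKT}(\bar p)$ for the quadratic NEP. Suppose that: (i) $\begin{pmatrix} A^k_1 \\ A^k_2 \end{pmatrix}$ is of full row rank for $k=1,\dots,N$; (ii) for each player $k$ and any $0\ne y^k\in M^k$, $(y^k)^{\mathrm T}P^k_{n_kn_k}y^k>0$; (iii) there exist parameters $\alpha_{i,j}>0$ ($1\le i,j\le N$, $j\ne i$) with $\sum_{j\ne i}\alpha_{i,j}=1$ for $i=1,\dots,N$, such that, with $T_{ki}:=P^k_{n_kn_i}+(P^i_{n_in_k})^{\mathrm T}$, for all players $i\ne k$ and any $0\ne y^k\in M^k$, $$(y^k)^{\mathrm T}\left(P^k_{n_kn_k}-\frac{1}{4\alpha_{i,k}\alpha_{k,i}}T_{ik}^{\mathrm T}B^i\left((B^i)^{\mathrm T}P^i_{n_in_i}B^i\right)^{-1}(B^i)^{\mathrm T}T_{ik}\right)y^k>0 .$$ Then $S_{\rm KKT}$ has a Lipschitz continuous single-valued localization around $\bar p$ for $(\bar x,\bar\lambda)$. Moreover, for every $(p,x(p),\lambda(p))\in{\rm gph}\,S_{\rm KKT}$ sufficiently close to $(\bar p,\bar x,\bar\lambda)$, $x(p)$ is a local Nash equilibrium of the quadratic NEP at $p$.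
   Context: Quadratic NEP. There are $N$ players; player $k$ has strategy $x^k\in\mathbb R^{n_k}$; $x=(x^1,\dots,x^N)\in\mathbb R^n$, $n=\sum n_k$. Parameters: $p=(u,v,w)$ with $u^k\in\mathbb R^{m_k}$, $v^k\in\mathbb R^{n_k}$, $w^k\in\mathbb R^{d_k}$. Given the others' strategies $x^{-k}$, player $k$ solves $$\min_{x^k}\ \tfrac12x^{\mathrm T}P^k(w^k)x-\langle c^k(w^k),x\rangle-\langle v^k,x^k\rangle\ \text{ s.t. } a^k_i(w^k)^{\mathrm T}x^k=b^k_i+u^k_i\ (i\le s_k),\ \ a^k_j(w^k)^{\mathrm T}x^k\le b^k_j+u^k_j\ (s_k<j\le m_k),$$ where $P^k(\cdot)\in\mathbb R^{n\times n}$, $c^k(\cdot)\in\mathbb R^n$, $a^k_i(\cdot)\in\mathbb R^{n_k}$ are continuously differentiable around $\bar w^k$, $b^k_i\in\mathbb R$ are constants. The reference parameter is $\bar p=(\bar u,\bar v,\bar w)=(0,0,0)$; write $P^k=P^k(\bar w^k)$, $a^k_i=a^k_i(\bar w^k)$. $P^k$ is symmetric, and $P^k_{n_jn_i}\in\mathbb R^{n_j\times n_i}$ denotes its block with rows corresponding to $x^j$ and columns to $x^i$. A point $x$ is a local Nash equilibrium (LNE) at $p$ if each $x^k$ is a local minimizer of player $k$'s problem given $x^{-k}$ and $p$. KKT mapping: with $L^k(x,\lambda^k;w^k)=\frac12x^{\mathrm T}P^k(w^k)x-\langle c^k(w^k),x\rangle+\sum_{i=1}^{m_k}\lambda^k_i(a^k_i(w^k)^{\mathrm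 T}x^k-b^k_i)$, $S_{\rm KKT}(p)$ is the set of $(x,\lambda)$, $\lambda=(\lambda^1,\dots,\lambda^N)$, $\lambda^k\in\mathbb R^{m_k}$, such that for each $k$: $v^k=\nabla_{x^k}L^k(x,\lambda^k;w^k)$; $a^k_i(w^k)^{\mathrm T}x^k-b^k_i=u^k_i$ for $i\le s_k$; and $\lambda^k_j\ge0$, $a^k_j(w^k)^{\mathrm T}x^k-b^k_j\le u^k_j$, $\lambda^k_j(a^k_j(w^k)^{\mathrm T}x^k-b^k_j-u^k_j)=0$ for $j>s_k$. At $(\bar p,\bar x,\bar\lambda)$: $I^k_1=\{1,\dots,s_k\}\cup\{i>s_k:\bar\lambda^k_i>0=(a^k_i)^{\mathrm T}\bar x^k-b^k_i\}$, $I^k_2=\{i>s_k:\bar\lambda^k_i=0=(a^k_i)^{\mathrm T}\bar x^k-b^k_i\}$. $A^k_1$, $A^k_2$ are the matrices with rows $(a^k_i)^{\mathrm T}$, $i\in I^k_1$, respectively $i\in I^k_2$. $M^k=\{y^k\in\mathbb R^{n_k}:(a^k_i)^{\mathrm T}y^k=0\ \forall i\in I^k_1\}$; $B^k$ is a matrix whose columns form a basis of $M^k$. A set-valued mapping $\Phi$ has a Lipschitz continuous single-valued localization around $\bar a$ for $\bar b$ if $\bar b\in\Phi(\bar a)$ and there are neighborhoods $U$ of $\bar a$, $V$ of $\bar b$ such that ${\rm gph}\,\Phi\cap(U\times V)$ is the graph of a Lipschitz continuous single-valued mapping $U\to V$. *)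

(* Defs.v *)
From HB Require Import structures.
From mathcomp Require Import all_boot all_order all_algebra.
From mathcomp Require Import all_classical all_reals all_analysis.

Set Implicit Arguments.
Unset Strict Implicit.
Unset Printing Implicit Defensive.

Import Order.TTheory GRing.Theory Num.Theory.
Import numFieldNormedType.Exports.

Local Open Scope classical_set_scope.
Local Open Scope ring_scope.

Section Generalities.
Context {R : realType}.

Definition dotp n (x y : 'cV[R]_n) : R := (x^T *m y) 0 0.

(* The derivative w |-> 'd f w is continuous for the operator norm. *)
Definition C1_around {V W : normedModType R} (f : V -> W) (a : V) : Prop :=
  \forall w \near a, differentiable f w /\
    forall e : R, 0 < e ->
      \forall w' \near w, forall h : V, `|'d f w' h - 'd f w h| <= e * `|h|.

Definition grad n (f : 'cV[R]_n -> R) (y : 'cV[R]_n) : 'cV[R]_n :=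
  \col_j 'D_(delta_mx j 0) f y.

Definition local_minimizer {V : normedModType R}
    (f : V -> R) (C : set V) (x : V) : Prop :=
  C x /\ \forall y \near x, C y -> f x <= f y.

Definition is_col_basis n r (B : 'M[R]_(n, r)) (S : set 'cV[R]_n) : Prop :=
  row_free B^T /\ forall y, S y <-> exists z : 'cV[R]_r, y = B *m z.

(* The last equation forces f to map U into U'. *)
Definition lipschitz_localization {V W : normedModType R}
    (Phi : V -> set W) (a : V) (b : W) : Prop :=
  Phi a b /\
  exists (U : set V) (U' : set W), [/\ nbhs a U, nbhs b U' &
    exists f : V -> W, [lipschitz f x | x in U] /\
      [set z | Phi z.1 z.2] `&` (U `*` U') = [set z | U z.1 /\ z.2 = f z.1]].

End Generalities.

(* The blocks x^k of x = (x^1,...,x^N) are submxcol x k, and the blocks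
   P^k_{n_j n_i} of P^k are submxblock (P^k) j i.  Indices are 0-based:
   constraint i of player k is an equality iff i < s_k. *)
Record quadNEP (R : realType) (N : nat) := QuadNEP {
  dimx : 'I_N -> nat;
  dimu : 'I_N -> nat;
  dimw : 'I_N -> nat;
  n_eq : 'I_N -> nat;
  Pmat : forall k, 'cV[R]_(dimw k) -> 'M[R]_(\sum_(i < N) dimx i)%N;
  cvec : forall k, 'cV[R]_(dimw k) -> 'cV[R]_(\sum_(i < N) dimx i)%N;
  avec : forall k, 'I_(dimu k) -> 'cV[R]_(dimw k) -> 'cV[R]_(dimx k);
  bvec : forall k, 'cV[R]_(dimu k) }.

Arguments Pmat {R N} q k w.
Arguments cvec {R N} q k w.
Arguments avec {R N} q k i w.
Arguments bvec {R N} q k.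

Section QuadNEP.
Context {R : realType} {N : nat} (G : quadNEP R N).

Definition profile := 'cV[R]_(\sum_(k < N) dimx G k)%N.
Definition multipliers := 'cV[R]_(\sum_(k < N) dimu G k)%N.
(* p = (u, v, w) *)
Definition parameters := ('cV[R]_(\sum_(k < N) dimu G k)%N *
  'cV[R]_(\sum_(k < N) dimx G k)%N * 'cV[R]_(\sum_(k < N) dimw G k)%N)%type.

Definition par_u (p : parameters) (k : 'I_N) : 'cV[R]_(dimu G k) :=
  submxcol p.1.1 k.
Definition par_v (p : parameters) (k : 'I_N) : 'cV[R]_(dimx G k) :=
  submxcol p.1.2 k.
Definition par_w (p : parameters) (k : 'I_N) : 'cV[R]_(dimw G k) :=
  submxcol p.2 k.

(* (y, x^{-k}) *)
Definition deviate (x : profile) (k : 'I_N) (y : 'cV[R]_(dimx G k)) : profile :=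
  \mxcol_i dfwith (fun j => submxcol x j) k y i.

Definition cost (k : 'I_N) (p : parameters) (x : profile) : R :=
  2^-1 * dotp x (Pmat G k (par_w p k) *m x) - dotp (cvec G k (par_w p k)) x
  - dotp (par_v p k) (submxcol x k).

Definition feasible (k : 'I_N) (p : parameters) : set 'cV[R]_(dimx G k) :=
  [set y | forall i : 'I_(dimu G k),
    if (i < n_eq G k)%N
    then dotp (avec G k i (par_w p k)) y = bvec G k i 0 + par_u p k i 0
    else dotp (avec G k i (par_w p k)) y <= bvec G k i 0 + par_u p k i 0].

Definition local_Nash (p : parameters) (x : profile) : Prop :=
  forall k, local_minimizer (fun y => cost k p (deviate x y))
              (@feasible k p) (submxcol x k).

Definition Lagrangian (k : 'I_N) (x : profile) (l : 'cV[R]_(dimu G k))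
    (w : 'cV[R]_(dimw G k)) : R :=
  2^-1 * dotp x (Pmat G k w *m x) - dotp (cvec G k w) x
  + \sum_i l i 0 * (dotp (avec G k i w) (submxcol x k) - bvec G k i 0).

Definition S_KKT (p : parameters) : set (profile * multipliers) :=
  [set z | forall k : 'I_N,
    let x := z.1 in
    let l := submxcol z.2 k in
    let g i := dotp (avec G k i (par_w p k)) (submxcol x k) - bvec G k i 0 in
    par_v p k =
      grad (fun y => Lagrangian (deviate x y) l (par_w p k)) (submxcol x k) /\
    forall i : 'I_(dimu G k),
      if (i < n_eq G k)%N then g i = par_u p k i 0
      else [/\ 0 <= l i 0, g i <= par_u p k i 0 &
               l i 0 * (g i - par_u p k i 0) = 0]].

(* The reference parameter is 0; what follows is evaluated there. *)

Definition Pblock (k j i : 'I_N) : 'M[R]_(dimx G j, dimx G i) :=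
  submxblock (Pmat G k 0) j i.

Definition abar (k : 'I_N) (i : 'I_(dimu G k)) : 'cV[R]_(dimx G k) :=
  avec G k i 0.

Definition active (k : 'I_N) (x : profile) (i : 'I_(dimu G k)) : bool :=
  dotp (abar i) (submxcol x k) - bvec G k i 0 == 0.

Definition I1 (x : profile) (l : multipliers) (k : 'I_N) :
    {set 'I_(dimu G k)} :=
  [set i : 'I_(dimu G k) |
    (i < n_eq G k)%N || (0 < submxcol l k i 0) && active x i].

Definition I2 (x : profile) (l : multipliers) (k : 'I_N) :
    {set 'I_(dimu G k)} :=
  [set i : 'I_(dimu G k) |
    [&& (n_eq G k <= i)%N, submxcol l k i 0 == 0 & active x i]].

Definition Amat (k : 'I_N) (J : {set 'I_(dimu G k)}) :
    'M[R]_(#|J|, dimx G k) :=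
  \matrix_(r < #|J|, j < dimx G k) abar (enum_val r) j 0.

Definition Mspace (x : profile) (l : multipliers) (k : 'I_N) :
    set 'cV[R]_(dimx G k) :=
  [set y | forall i, i \in I1 x l k -> dotp (abar i) y = 0].

Definition Tmat (k i : 'I_N) : 'M[R]_(dimx G k, dimx G i) :=
  Pblock k k i + (Pblock i i k)^T.

End QuadNEP.

Arguments feasible {R N} G k p _.
Arguments Mspace {R N G} x l k _.

(* Main.v *)
Require Import Defs.
From HB Require Import structures.
From mathcomp Require Import all_boot all_order all_algebra.
From mathcomp Require Import all_classical all_reals all_analysis.
From mathcomp Require Import ring lra.

Set Implicit Arguments.
Unset Strict Implicit.
Unset Printing Implicit Defensive.

Import Order.TTheory GRing.Theory Num.Theory.
Import numFieldNormedType.Exports.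

Local Open Scope classical_set_scope.
Local Open Scope ring_scope.

(* Near the reference point the KKT system is a mixed linear complementarity
   problem (MLCP) in (x, lambda) whose data are Lipschitz in p: the constraints
   in I1 are equations, those in I2 keep their complementarity condition, and
   the remaining multipliers vanish. Conditions (i)-(iii) give the matrix S of
   this problem at p = 0 a mixed P-property: completing squares, (iii) makes the
   form sum_k (y^k)^T sum_i P^k_{n_k n_i} y^i positive on the product of the
   M^k, and (i) recovers the multipliers. The P-property yields existence, by an
   induction on the number of complementarity conditions, and by compactness of
   the unit sphere an error bound, hence uniqueness and Lipschitz dependence on
   the data; the error bound survives small perturbations of S.
   For local Nash equilibria, near p = 0 every direction d of player k satisfies
   either sum_(I1) |<a_i, d>| >= c |d| or d^T P^k d >= 0. In the first case the
   cost grows linearly along feasible d, because the multipliers of I1 are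
   bounded away from 0; in the second it grows by convexity. *)

(** * Mixed linear complementarity problems *)

Section MixedLCP.
Context {R : realFieldType} {n : nat}.
Implicit Types (S : 'M[R]_n) (J : {set 'I_n}) (y z : 'cV[R]_n).

Definition mlcp S y J z := forall i,
  if i \in J
  then [/\ 0 <= z i 0, 0 <= (S *m z + y) i 0 & z i 0 * (S *m z + y) i 0 = 0]
  else (S *m z + y) i 0 = 0.

(** The relation satisfied by the difference of two solutions; [w] is kept separate from [z] so that
    perturbed images [S *m z + e] are covered. [is_true] puts both branches in [Prop]. *)
Definition sign_reversed J (w z : 'cV[R]_n) := forall i,
  if i \in J then is_true (z i 0 * w i 0 <= 0) else w i 0 = 0.

(* For J = setT this says that S is a P-matrix, for J = set0 that S is
   invertible. *)
Definition mixed_P S J := forall z, sign_reversed J (S *m z) z -> z = 0.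

(** A kernel vector has image zero, which is sign reversed for every [J]. *)
Lemma mixed_P_unitmx S J : mixed_P S J -> S \in unitmx.
Proof.
move=> PS; rewrite -unitmx_tr -row_free_unit -kermx_eq0.
apply/rowV0P => v /sub_kermxP /(congr1 trmx).
rewrite trmx_mul trmxK trmx0 => Sv.
apply: trmx_inj; rewrite trmx0; apply: PS => i.
by rewrite Sv [in (0 : 'cV_n) _ _]mxE mulr0 lexx; case: ifP.
Qed.

(** On [J], complementarity reduces the product of the differences to [- z1 w2 - z2 w1], and both
    cross terms are products of nonnegative numbers. *)
Lemma mlcp_sign_reversed S1 S2 J y1 y2 z1 z2 :
  mlcp S1 y1 J z1 -> mlcp S2 y2 J z2 ->
  sign_reversed J ((S1 *m z1 + y1) - (S2 *m z2 + y2)) (z1 - z2).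
Proof.
move=> H1 H2 i; move: (H1 i) (H2 i).
rewrite [(z1 - z2) i 0]mxE [(- z2) i 0]mxE.
rewrite [((S1 *m z1 + y1) - _) i 0]mxE [(- (S2 *m z2 + y2)) i 0]mxE.
move: (S1 *m z1 + y1) (S2 *m z2 + y2) => w1 w2; case: ifP => _.
  move=> [z1_ge0 w1_ge0 e1] [z2_ge0 w2_ge0 e2].
  by have := mulr_ge0 z1_ge0 w2_ge0; have := mulr_ge0 z2_ge0 w1_ge0; lra.
by move=> -> ->; rewrite subr0.
Qed.

(** As an equation with right-hand data [y], row [j] becomes [z j 0 + y j 0 = 0] and fixes this
    coordinate. *)
Definition pin_row S j : 'M[R]_n :=
  \matrix_(a, b) if a == j then (a == b)%:R else S a b.

Lemma mul_pin_row S j z a :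
  (pin_row S j *m z) a 0 = if a == j then z j 0 else (S *m z) a 0.
Proof.
rewrite mxE; case: (eqVneq a j) => [->|aj].
  rewrite (bigD1 j) //= mxE !eqxx mul1r big1 ?addr0// => b bj.
  by rewrite mxE eqxx eq_sym (negPf bj) mul0r.
by rewrite mxE; apply: eq_bigr => b _; rewrite mxE (negPf aj).
Qed.

(* Induction on J = j |: J'.  First solve with row j as an equation; if the
   solution has z_j < 0, solve again with z_j pinned to 0: the P-property,
   applied to the difference of both solutions, makes row j nonnegative. *)
Lemma mlcp_exists S J y : mixed_P S J -> exists z, mlcp S y J z.
Proof.
elim: {J}#|J| {-2}J (erefl #|J|) S y => [|c IH] J cardJ S y PS.
  move/eqP: cardJ; rewrite cards_eq0 => /eqP J0; rewrite {}J0 in PS *.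
  exists (invmx S *m - y) => i; rewrite inE mulmxA mulmxV ?mul1mx ?addNr ?mxE//.
  exact: mixed_P_unitmx PS.
have [j jJ] : exists j, j \in J by apply/card_gt0P; rewrite cardJ.
pose J' := J :\ j.
have cJ' : #|J'| = c by move: cardJ; rewrite (cardsD1 j) jJ => -[].
have jJ' : j \notin J' by rewrite !inE eqxx.
have JJ' i : i != j -> (i \in J') = (i \in J) by rewrite !inE => ->.
(* Turning row [j] into an equation keeps the P-property: one factor at [j] vanishes, [(S *m z) j 0]
   here and [z j 0] for the pinned matrix, so the vector is sign reversed for [J] as well. *)
have PS' : mixed_P S J'.
  move=> z sz; apply: PS => i; have := sz i.
  case: (eqVneq i j) => [->|ij]; last by rewrite JJ'.
  by rewrite (negPf jJ') jJ => ->; rewrite mulr0.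
have Ppin : mixed_P (pin_row S j) J'.
  move=> z sz; apply: PS => i; have := sz i; rewrite mul_pin_row.
  case: (eqVneq i j) => [->|ij]; last by rewrite JJ'.
  by rewrite (negPf jJ') jJ => ->; rewrite mul0r.
have [z zP] := IH J' cJ' S y PS'.
have zj : (S *m z + y) j 0 = 0 by have := zP j; rewrite (negPf jJ').
have [z_ge0|z_lt0] := leP 0 (z j 0).
  exists z => i; have := zP i; case: (eqVneq i j) => [->|ij];
    last by rewrite JJ'.
  by rewrite (negPf jJ') jJ => ->; rewrite mulr0; split.
(* The zero at [j] makes the pinned row read [x j 0 = 0]. *)
pose y' : 'cV[R]_n := \col_a if a == j then 0 else y a 0.
have pinE (x : 'cV[R]_n) i : i != j -> (pin_row S j *m x + y') i 0 =
  (S *m x + y) i 0.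
  by move=> ij; rewrite [LHS]mxE mul_pin_row [y' i 0]mxE (negPf ij) [RHS]mxE.
have [x xP] := IH J' cJ' (pin_row S j) y' Ppin.
have xj : x j 0 = 0.
  by have := xP j; rewrite (negPf jJ') mxE mul_pin_row [y' j 0]mxE eqxx addr0.
have xP' i : i != j -> if i \in J then
    [/\ 0 <= x i 0, 0 <= (S *m x + y) i 0 & x i 0 * (S *m x + y) i 0 = 0]
    else (S *m x + y) i 0 = 0.
  by move=> ij; have := xP i; rewrite JJ'// pinE.
suff wj : 0 <= (S *m x + y) j 0.
  exists x => i; case: (eqVneq i j) => [->|]; last exact: xP'.
  by rewrite jJ xj mul0r lexx wj.
rewrite leNgt; apply/negP => wj.
suff xz : x - z = 0.
  by move: z_lt0; rewrite -(subr0_eq xz) xj ltxx.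
have dE i : (S *m (x - z)) i 0 = (S *m x + y) i 0 - (S *m z + y) i 0.
  by rewrite mulmxBr !mxE; ring.
apply: PS => i; rewrite dE; have [->|ij] := eqVneq i j.
  rewrite jJ zj subr0 mulr_ge0_le0 ?(ltW wj)//.
  by rewrite !mxE xj sub0r oppr_ge0 ltW.
have := xP' _ ij; have := zP i; rewrite JJ'//; case: ifP => iJ; last first.
  by move=> -> ->; rewrite subr0.
rewrite [(x - z) i 0]mxE [(- z) i 0]mxE.
move=> [z_ge0 w_ge0 zw] [x_ge0 v_ge0 xv].
by have := mulr_ge0 x_ge0 w_ge0; have := mulr_ge0 z_ge0 v_ge0; lra.
Qed.

End MixedLCP.

(** * Maximum norm of matrices, compactness of the sphere, error bound *)

Section MatrixNorm.
Context {R : realType}.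

Lemma ler_mx_normP m n (A : 'M[R]_(m, n)) c : 0 <= c ->
  `|A| <= c <-> forall i j, `|A i j| <= c.
Proof.
move=> c_ge0; rewrite [`|A|]mx_normrE; split=> [/bigmax_leP[_ Ac] i j|Ac].
  exact: (Ac (i, j)).
by apply/bigmax_leP; split=> // ij _; exact: Ac.
Qed.

Lemma ler_mx_entry m n (A : 'M[R]_(m, n)) i j : `|A i j| <= `|A|.
Proof. by have /ler_mx_normP := lexx `|A|; exact. Qed.

Lemma norm_trmx m n (A : 'M[R]_(m, n)) : `|A^T| = `|A|.
Proof.
apply/eqP; rewrite eq_le; apply/andP; split; apply/ler_mx_normP => // i j.
  by rewrite mxE ler_mx_entry.
by have := ler_mx_entry A^T j i; rewrite mxE.
Qed.

Lemma norm_mulmx m n p (A : 'M[R]_(m, n)) (B : 'M[R]_(n, p)) :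
  `|A *m B| <= n%:R * `|A| * `|B|.
Proof.
apply/ler_mx_normP => [|i j]; first by rewrite !mulr_ge0.
rewrite mxE (le_trans (ler_norm_sum _ _ _))// -mulrA.
rewrite mulr_natl -[X in _ *+ X]card_ord -sumr_const ler_sum// => k _.
by rewrite normrM ler_pM// ler_mx_entry.
Qed.

Lemma trmx_continuous m n : continuous (@trmx R m n).
Proof.
move=> A; apply/(@cvgrPdist_lt _ _ _ (nbhs A)) => e e_gt0; near=> B.
by rewrite -linearB/= norm_trmx; near: B; exact: cvgr_dist_lt.
Unshelve. all: by end_near. Qed.

(** Extreme value theorem on the compact unit sphere; transposition preserves the norm and carries
    the sphere to row vectors. *)
Lemma sphere_min_gt0 n (phi : 'cV[R]_n -> R) : continuous phi ->
  (forall d, d != 0 -> 0 < phi d) ->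
  exists2 c, 0 < c & forall d, `|d| = 1 -> c <= phi d.
Proof.
move=> phi_cont phi_gt0.
pose A := [set v : 'rV[R]_n | `|v| = 1].
have A0 v : `|v| = 1 :> R -> (v : 'cV[R]_n) != 0.
  by move=> v1; rewrite -normr_eq0 v1 oner_neq0.
have [A_ne|A_empty] := pselect (A !=set0); last first.
  (* Over an empty sphere, as for [n = 0], any positive constant will do. *)
  exists 1 => // d d1; case: A_empty; exists d^T.
  by rewrite /A/= norm_trmx.
have A_compact : compact A.
  apply: bounded_closed_compact.
    exists 1; split=> // M M1 v /= ->; exact: ltW.
  apply: (@preimage_closed _ _ (fun v : 'rV[R]_n => `|v|) [set 1]).
    by move=> v _; exact: norm_continuous.
  exact: closed_eq.
have psi_cont : continuous (phi \o @trmx R 1 n).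
  by move=> v; apply: continuous_comp; [exact: trmx_continuous|exact: phi_cont].
have [v vA vmin] := EVT_min_rV A_ne A_compact (continuous_subspaceT psi_cont).
exists (phi v^T) => [|d d1].
  by apply/phi_gt0/A0; rewrite norm_trmx; move: vA; rewrite inE.
by rewrite -[d]trmxK; apply: vmin; rewrite inE /A/= norm_trmx.
Qed.

Lemma continuous_sumr (T : topologicalType) (I : finType) (F : I -> T -> R) :
  (forall i, continuous (F i)) -> continuous (fun x => \sum_i F i x).
Proof. by move=> cF; apply: continuous_big => //; exact: add_continuous. Qed.

Lemma mulmx_coord_continuous m n (S : 'M[R]_(m, n)) i :
  continuous (fun d : 'cV[R]_n => (S *m d) i 0).
Proof.
rewrite (_ : (fun d : 'cV_n => _) = fun d => \sum_j S i j * d j 0).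
  apply: continuous_sumr => j d.
  by apply: continuousM; [exact: cst_continuous|exact: coord_continuous].
by apply/funext => x; rewrite mxE.
Qed.

(** [psi i] measures how far row [i] is from being sign reversed: twice the positive part of the
    product on [J], the absolute value of the row elsewhere. By the P-property the sum of the
    [psi i] vanishes only at 0, so it is at least some [c > 0] on the unit sphere. If adding [e]
    restores sign reversal there, each [psi i] is at most twice the norm of [e], which bounds that
    norm from below. *)
Lemma mixed_P_error_bound n (S : 'M[R]_n) J : mixed_P S J ->
  exists2 C, 0 < C & forall d e, sign_reversed J (S *m d + e) d ->
    `|d| <= C * `|e|.
Proof.
move=> PS.
pose psi i (d : 'cV[R]_n) := if i \in J
  then d i 0 * (S *m d) i 0 + `|d i 0 * (S *m d) i 0| else `|(S *m d) i 0|.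
have psi_ge0 i d : 0 <= psi i d.
  rewrite /psi; case: ifP => // _; rewrite -normrN -[X in X + _]opprK addrC.
  by rewrite subr_ge0 ler_norm.
have [||c c_gt0 cP] := @sphere_min_gt0 n (fun d => \sum_i psi i d).
- apply: (@continuous_sumr _ _ psi) => i d; rewrite /psi; case: (i \in J).
    pose f (d : 'cV[R]_n) := d i 0 * (S *m d) i 0.
    have cont : {for d, continuous f}.
      apply: continuousM; first exact: coord_continuous.
      exact: mulmx_coord_continuous.
    apply: (@continuousD _ _ _ f (fun d => `|f d|)) => //.
    by apply: continuous_comp => //; exact: norm_continuous.
  apply: (@continuous_comp _ _ _ (fun d => (S *m d) i 0) (fun x => `|x|)).
    exact: mulmx_coord_continuous.
  exact: norm_continuous.
- move=> d d_neq0; rewrite lt_def sumr_ge0// andbT; apply: contra_neq d_neq0.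
  move=> /eqP; rewrite psumr_eq0// => /allP psi0; apply: PS => i.
  have := psi0 i; rewrite mem_index_enum => /(_ isT) /eqP; rewrite /psi.
  case: ifP => _; last by move/eqP; rewrite normr_eq0 => /eqP.
  by move/eqP; rewrite addr_eq0 => /eqP ->; rewrite oppr_le0.
(* [n.+1] instead of [n] keeps the constant positive when [n = 0]. *)
exists (2 * n.+1%:R / c); first by rewrite divr_gt0 ?mulr_gt0.
move=> d e sde; have [->|d_neq0] := eqVneq d 0.
  by rewrite normr0 mulr_ge0// divr_ge0 ?mulr_ge0 ?ltW.
have d_gt0 : 0 < `|d| by rewrite normr_gt0.
(* Sign reversal survives a common positive scaling of [d] and [e], so [d] may be normalised. *)
pose d1 := `|d|^-1 *: d; pose e1 := `|d|^-1 *: e.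
have d1n : `|d1| = 1 by rewrite normrZ normfV normr_id mulVf// gt_eqF.
have e1n : `|e1| = `|e| / `|d| by rewrite normrZ normfV normr_id mulrC.
have sde1 : sign_reversed J (S *m d1 + e1) d1.
  have -> : S *m d1 + e1 = `|d|^-1 *: (S *m d + e) by rewrite scalerDr
    scalemxAr.
  have sE (k : R) (v : 'cV[R]_n) i : (k *: v) i 0 = k * v i 0 by rewrite mxE.
  move=> i; have := sde i; rewrite /d1 !sE; case: ifP => _; last first.
    by move=> ->; rewrite mulr0.
  move=> ?; rewrite mulrACA; rewrite mulr_ge0_le0// mulr_ge0// invr_ge0 ltW//.
have /le_trans/(_ _) := cP _ d1n => /(_ (n%:R * (2 * `|e1|))) cn.
have : c <= n%:R * (2 * `|e1|).
  apply: cn; rewrite mulr_natl -[X in _ *+ X]card_ord -sumr_const.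
  apply: ler_sum => i _; rewrite /psi; have := sde1 i.
  rewrite [(S *m d1 + e1) i 0]mxE.
  have ei := ler_mx_entry e1 i 0; have := ler_mx_entry d1 i 0; rewrite d1n.
  case: ifP => _ di.
    rewrite mulrDr => si.
    have dei : `|d1 i 0 * e1 i 0| <= `|e1|.
      by rewrite normrM -[leRHS]mul1r ler_pM.
    have := ler_norm (- (d1 i 0 * e1 i 0)); rewrite normrN => dei'.
    by have [?|?] := ger0P (d1 i 0 * (S *m d1) i 0); have := normr_ge0 e1; lra.
  move/eqP; rewrite addr_eq0 => /eqP ->; rewrite normrN.
  by have := normr_ge0 e1; lra.
rewrite e1n !mulrA ler_pdivlMr// => cd.
rewrite mulrAC ler_pdivlMr// mulrC; apply: le_trans cd _.
by rewrite [n%:R * 2]mulrC ler_wpM2r// ler_wpM2l// ler_nat.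
Qed.

End MatrixNorm.

(** * Local Lipschitz continuity and strong regularity *)

Section LipschitzNear.
Context {R : realType} {V : normedModType R}.

Definition lip_near (W : normedModType R) (f : V -> W) (a : V) :=
  exists (C : R) (U : set V), [/\ 0 <= C, nbhs a U &
    forall x y, U x -> U y -> `|f x - f y| <= C * `|x - y|].

Lemma lip_near_cst (W : normedModType R) (c : W) a : lip_near (fun=> c) a.
Proof.
exists 0, setT; split=> //; first exact: filterT.
by move=> x y _ _; rewrite subrr normr0 mul0r.
Qed.

Lemma lip_nearD (W : normedModType R) (f g : V -> W) a :
  lip_near f a -> lip_near g a -> lip_near (fun x => f x + g x) a.
Proof.
move=> [C [U [C0 aU fU]]] [D [U' [D0 aU' gU]]]; exists (C + D), (U `&` U').
split; [exact: addr_ge0|exact: filterI|move=> x y [Ux U'x] [Uy U'y]].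
rewrite opprD addrACA mulrDl (le_trans (ler_normD _ _))//.
by rewrite lerD ?fU ?gU.
Qed.

Lemma lip_nearZ (W : normedModType R) (k : R) (f : V -> W) a :
  lip_near f a -> lip_near (fun x => k *: f x) a.
Proof.
move=> [C [U [C0 aU fU]]]; exists (`|k| * C), U; split=> //.
  exact: mulr_ge0.
by move=> x y Ux Uy; rewrite -scalerBr normrZ -mulrA ler_wpM2l ?fU.
Qed.

Lemma lip_nearN (W : normedModType R) (f : V -> W) a :
  lip_near f a -> lip_near (fun x => - f x) a.
Proof.
move=> [C [U [C0 aU fU]]]; exists C, U; split=> // x y Ux Uy.
by rewrite -opprD normrN; exact: fU.
Qed.

Lemma lip_near_mx m n (f : V -> 'M[R]_(m, n)) a :
  (forall i j, lip_near (fun x => f x i j) a) -> lip_near f a.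
Proof.
move=> fL; have {}fL (ij : 'I_m * 'I_n) :
    exists CU : R * set V, [/\ 0 <= CU.1, nbhs a CU.2 &
      forall x y, CU.2 x -> CU.2 y -> `|f x ij.1 ij.2 - f y ij.1 ij.2| <=
        CU.1 * `|x - y|].
  by have [C [U H]] := fL ij.1 ij.2; exists (C, U).
have {fL} [CU CUP] := choice fL.
have C_ge0 ij : 0 <= (CU ij).1 by case: (CUP ij).
exists (\sum_ij (CU ij).1), [set x | forall ij, (CU ij).2 x]; split.
- exact: sumr_ge0.
- by apply: filter_forall => ij; case: (CUP ij).
- move=> x y Ux Uy; apply/ler_mx_normP => [|i j].
    by rewrite mulr_ge0// sumr_ge0.
  have [_ _ H] := CUP (i, j); rewrite !mxE (le_trans (H _ _ _ _))//.
  rewrite ler_wpM2r// (bigD1 (i, j))//= lerDl sumr_ge0//.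
Qed.

Lemma lip_near_entry m n (f : V -> 'M[R]_(m, n)) a i j :
  lip_near f a -> lip_near (fun x => f x i j : R^o) a.
Proof.
move=> [C [U [C0 aU fU]]]; exists C, U; split=> // x y Ux Uy.
by apply: le_trans (fU _ _ Ux Uy); have := ler_mx_entry (f x - f y) i j;
  rewrite !mxE.
Qed.

Lemma lip_near_dist (W : normedModType R) (f : V -> W) a e :
  lip_near f a -> 0 < e -> \forall x \near a, `|f x - f a| < e.
Proof.
move=> [C [U [C0 aU fU]]] e_gt0.
(* [C] may be 0; [C + 1] can be divided by. *)
have Ua := nbhs_singleton aU; have C1 : 0 < C + 1 by rewrite ltr_wpDl.
near=> x; apply: (@le_lt_trans _ _ (C * `|x - a|)).
  by apply: fU => //; near: x.
apply: (@le_lt_trans _ _ ((C + 1) * `|x - a|)).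
  by rewrite ler_wpM2r// lerDl.
rewrite mulrC -ltr_pdivlMr//.
near: x; apply/nbhs_normP; exists (e / (C + 1)) => /=; first exact: divr_gt0.
by move=> x; rewrite distrC.
Unshelve. all: by end_near. Qed.

End LipschitzNear.

Lemma lip_near_comp {R : realType} (V V' W : normedModType R)
    (g : V -> V') (f : V' -> W) a :
  lip_near g a -> lip_near f (g a) -> lip_near (fun x => f (g x)) a.
Proof.
move=> gL [D [U' [D0 aU' fU]]]; have [C [U [C0 aU gU]]] := gL.
exists (D * C), (U `&` [set x | U' (g x)]); split; first exact: mulr_ge0.
  apply: filterI => //; have [e/= e0 eU] := (nbhs_normP _ _).1 aU'.
  near=> x; apply: eU => /=; rewrite distrC.
  by near: x; exact: lip_near_dist.
move=> x y [Ux U'x] [Uy U'y]; rewrite (le_trans (fU _ _ _ _))//.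
by rewrite -mulrA ler_wpM2l ?gU.
Unshelve. all: by end_near. Qed.

Section StrongRegularity.
Context {R : realType} {V : normedModType R} {n : nat}.
Variables (S : V -> 'M[R]_n) (y : V -> 'cV[R]_n) (J : {set 'I_n}) (a : V).

(** The term [(S x - S a) *m d] is counted as part of the error. For [x] close to [a] its
    contribution is at most half the norm of [d] and is absorbed on the left, at the price of
    doubling the constant. *)
Lemma mixed_P_error_bound_near : mixed_P (S a) J -> lip_near S a ->
  exists2 C, 0 < C & \forall x \near a, forall d e,
    sign_reversed J (S x *m d + e) d -> `|d| <= C * `|e|.
Proof.
move=> /mixed_P_error_bound[C C0 CP] SL; exists (2 * C); first exact: mulr_gt0.
have D0 : 0 < 2 * (C * n.+1%:R) by rewrite !mulr_gt0.
near=> x => d e sd.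
have Sx : `|S x - S a| < (2 * (C * n.+1%:R))^-1.
  by near: x; apply: lip_near_dist => //; rewrite invr_gt0.
have /CP : sign_reversed J (S a *m d + (e + (S x - S a) *m d)) d.
  by rewrite addrCA -mulmxDl subrKC addrC.
move=> /le_trans/(_ (ler_wpM2l (ltW C0) (ler_normD _ _))) dle.
have Sd : C * `|(S x - S a) *m d| <= 2^-1 * `|d|.
  rewrite (le_trans (ler_wpM2l (ltW C0) (norm_mulmx _ _)))//.
  rewrite !mulrA ler_wpM2r//.
  apply: (@le_trans _ _ (C * n.+1%:R * (2 * (C * n.+1%:R))^-1)).
    apply: ler_pM => //; [|by rewrite ler_wpM2l ?(ltW C0)// ler_nat|exact: ltW].
    by rewrite mulr_ge0// ltW.
  by rewrite invfM mulrCA divff ?mulr1// gt_eqF// mulr_gt0.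
by rewrite mulrDr in dle; lra.
Unshelve. all: by end_near. Qed.

(** Existence near [a] comes from [mlcp_exists]. The difference of two solutions, possibly for
    different parameters, is sign reversed up to the change of the data, so one error bound yields
    both uniqueness and the Lipschitz estimate. *)
Lemma mlcp_strong_regularity zbar :
    mixed_P (S a) J -> lip_near S a -> lip_near y a ->
    mlcp (S a) (y a) J zbar ->
  exists f : V -> 'cV[R]_n, lip_near f a /\
    \forall x \near a, forall z, mlcp (S x) (y x) J z <-> z = f x.
Proof.
move=> PS SL yL zbarP.
have [C C_gt0 CP] := mixed_P_error_bound_near PS SL.
pose f x : 'cV[R]_n := xget 0 [set z | mlcp (S x) (y x) J z].
(* The P-property at nearby [x] is the error bound with [e = 0]. *)
have PS' : \forall x \near a, mixed_P (S x) J.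
  near=> x => z sz; apply/eqP; rewrite -normr_le0 -[leRHS](mulr0 C).
  rewrite -[X in C * X](@normr0 _ 'cV[R]_n).
  by move: z sz; near: x; apply: filterS CP => x xP z sz; apply: xP;
    rewrite addr0.
have [L1 [U1 [L1_ge0 U1a SU]]] := SL; have [L2 [U2 [L2_ge0 U2a yU]]] := yL.
pose U := [set x | [/\ U1 x, U2 x, mixed_P (S x) J & forall d e,
  sign_reversed J (S x *m d + e) d -> `|d| <= C * `|e| ]].
have aU : nbhs a U.
  by near=> x; split; near: x.
have Ua := nbhs_singleton aU.
have lip x x' z z' : U x -> U x' -> mlcp (S x) (y x) J z ->
    mlcp (S x') (y x') J z' ->
    `|z - z'| <= C * (n%:R * L1 * `|z'| + L2) * `|x - x'|.
  move=> [U1x U2x _ Ex] [U1x' U2x' _ _] zP z'P.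
  have := mlcp_sign_reversed zP z'P.
  have -> : S x *m z + y x - (S x' *m z' + y x') =
      S x *m (z - z') + ((S x - S x') *m z' + (y x - y x')).
    by rewrite mulmxBr mulmxBl [RHS]addrA subrKA opprD addrACA.
  move=> /Ex /le_trans; apply; rewrite -mulrA ler_wpM2l ?(ltW C_gt0)//.
  rewrite (le_trans (ler_normD _ _))// mulrDl lerD ?yU//.
  rewrite (le_trans (norm_mulmx _ _))// [leRHS]mulrAC ler_wpM2r//
    -mulrA ler_wpM2l//.
  exact: SU.
have solx x : U x -> mlcp (S x) (y x) J (f x).
  case=> _ _ Px _.
  exact: (@xgetPex _ 0 [set z | mlcp (S x) (y x) J z] (mlcp_exists _ Px)).
(* The constant in [lip] depends on the norm of one solution. Comparison with [zbar] shows that [K]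
   bounds this norm at all parameters of [U] within distance 1 of [a]. *)
pose K := `|zbar| + C * (n%:R * L1 * `|zbar| + L2).
have K_ge0 : 0 <= K by rewrite addr_ge0// mulr_ge0 ?(ltW C_gt0) ?addr_ge0
  ?mulr_ge0.
exists f; split.
  exists (C * (n%:R * L1 * K + L2)), (U `&` [set x | `|a - x| < 1]).
  split; first by rewrite mulr_ge0 ?(ltW C_gt0) ?addr_ge0 ?mulr_ge0.
    by apply: filterI => //; apply/nbhs_normP; exists 1 => //=.
  move=> x x' [Ux x1] [Ux' x'1]; have := lip _ _ _ _ Ux Ux' (solx _ Ux) (solx _
    Ux').
  move=> /le_trans; apply; rewrite ler_wpM2r// ler_wpM2l ?(ltW C_gt0)// lerD2r.
  rewrite ler_wpM2l ?mulr_ge0//.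
  rewrite -[f x'](subrK zbar) addrC (le_trans (ler_normD _ _))// lerD2l.
  rewrite (le_trans (lip _ _ _ _ Ux' Ua (solx _ Ux') zbarP))//.
  rewrite ler_piMr ?mulr_ge0 ?(ltW C_gt0) ?addr_ge0 ?mulr_ge0// distrC.
  exact: ltW.
near=> x => z; have Ux : U x by near: x.
split=> [zP|->]; last exact: solx.
have := lip _ _ _ _ Ux Ux zP (solx _ Ux).
by rewrite subrr normr0 mulr0 normr_le0 subr_eq0 => /eqP.
Unshelve. all: by end_near. Qed.

End StrongRegularity.

(** * Derivatives along lines and local Lipschitz continuity of C1 maps *)

Section Derivatives.
Context {R : realType}.

(** The difference quotient is exactly [a + h * b]. *)
Lemma derive_quadratic (V : normedModType R) (f : V -> R) x v (a b : R) :
  (forall h : R, f (h *: v + x) = f x + h * a + h ^+ 2 * b) -> 'D_v f x = a.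
Proof.
move=> fE; apply: cvg_lim => //=.
have : (a + h * b) @[h --> 0^'] --> a + 0 * b.
  apply: cvgD; [exact: cvg_cst|apply: cvgM; last exact: cvg_cst].
  by move=> A; exact: nbhs_dnbhs.
rewrite mul0r addr0; apply: cvg_trans; apply: near_eq_cvg; near=> h.
have h_neq0 : h != 0 by near: h; exact: nbhs_dnbhs_neq.
rewrite fE (_ : _ - f x = h * (a + h * b)); last by ring.
by rewrite /GRing.scale/= mulKf.
Unshelve. all: by end_near. Qed.

Lemma is_derive_along_line (V : normedModType R) m n (f : V -> 'M[R]_(m, n))
    x v (t : R) i j : differentiable f (x + t *: v) ->
  is_derive t 1 (fun s => f (x + s *: v) i j) ('d f (x + t *: v) v i j).
Proof.
move=> df; have fv : derivable f (x + t *: v) v by exact: diff_derivable.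
have : (h^-1 *: ((f \o shift (x + t *: v)) (h *: v) - f (x + t *: v))) i j
    @[h --> 0^'] --> 'd f (x + t *: v) v i j.
  rewrite -deriveE//.
  exact: (cvg_comp _ _ fv (@coord_continuous _ _ _ i j _)).
rewrite (_ : (fun h => _) = fun h : R => h^-1 *:
    (((fun s => f (x + s *: v) i j) \o shift t) (h *: 1) - f (x + t *: v) i j)).
  by move=> fc; split; [apply/cvg_ex; eexists; exact: fc|exact: cvg_lim].
apply/funext => h /=; rewrite !mxE /GRing.scale/= mulr1.
by rewrite addrCA -scalerDl.
Qed.

(** Continuity of the derivative with tolerance 1 bounds it by [k + 1] near [a], where [k] bounds
    the derivative at [a]. Balls are convex, so the mean value theorem applies on segments, entry by
    entry; with the maximum norm the constant is unchanged. *)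
Lemma C1_around_lip_near (V : normedModType R) m n (f : V -> 'M[R]_(m, n)) a :
  C1_around f a -> lip_near f a.
Proof.
move=> fC1; have [dfa /(_ 1 ltr01) df_near] := nbhs_singleton fC1.
have [k k_gt0 kP] := linear_lipschitz (diff_continuous dfa).
have fd : \forall w \near a, differentiable f w by apply: filterS fC1 => w [].
have : \forall w \near a, differentiable f w /\
    forall h, `|'d f w h| <= (k + 1) * `|h|.
  near=> w; split; first by near: w.
  have dn : forall h, `|'d f w h - 'd f a h| <= 1 * `|h| by near: w.
  move=> h; rewrite -['d f w h](subrK ('d f a h)) addrC mulrDl.
  rewrite (le_trans (ler_normD _ _))// lerD ?kP ?dn//.
move=> /nbhs_normP[e/= e_gt0 eP].
exists (k + 1), [set x | `|a - x| < e]; split.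
- by rewrite addr_ge0// ltW.
- by apply/nbhs_normP; exists e.
move=> y x /= ye xe; apply/ler_mx_normP => [|i j].
  by rewrite mulr_ge0// addr_ge0// ltW.
have seg t : 0 <= t <= 1 -> `|a - (x + t *: (y - x))| < e.
  move=> /andP[t0 t1].
  have -> : a - (x + t *: (y - x)) = (1 - t) *: (a - x) + t *: (a - y).
    rewrite scalerBl scale1r -addrA [- _ + _]addrC -scalerBr opprD addrA.
    rewrite -scalerN; congr (_ + _ *: _).
    by rewrite !opprB [RHS]addrC subrKA.
  rewrite (le_lt_trans (ler_normD _ _))// !normrZ.
  rewrite (ger0_norm t0) ger0_norm ?subr_ge0//.
  have m_lt : Num.max `|a - x| `|a - y| < e by rewrite gt_max xe ye.
  apply: le_lt_trans m_lt; set M := Num.max _ _.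
  rewrite -[leRHS]mul1r -[X in X * M](subrK t) [leRHS]mulrDl.
  by rewrite lerD// ler_wpM2l ?subr_ge0// le_max lexx ?orbT.
pose g (s : R) : R := f (x + s *: (y - x)) i j.
have dg (s : R) : 0 <= s <= 1 ->
    is_derive s 1 g ('d f (x + s *: (y - x)) (y - x) i j).
  by move=> /seg /eP[df _]; exact: is_derive_along_line.
have [s||s s01] := @MVT_segment R g
  (fun s => 'd f (x + s *: (y - x)) (y - x) i j) 0 1 ler01.
- by rewrite in_itv/= => /andP[s0 s1]; apply: dg; rewrite !ltW.
- apply: derivable_within_continuous => s; rewrite in_itv/= => s01.
  by have [] := dg _ s01.
rewrite /g scale1r scale0r addr0 subrKC subr0 mulr1 !mxE => ->.
move: s01; rewrite in_itv/= => /seg /eP[_ dfle].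
by rewrite (le_trans (ler_mx_entry _ _ _)).
Unshelve. all: by end_near. Qed.

End Derivatives.

(** * The KKT system in global coordinates *)

Section DotProduct.
Context {R : realType}.

Lemma dotpE n (x y : 'cV[R]_n) : dotp x y = \sum_i x i 0 * y i 0.
Proof. by rewrite /dotp mxE; apply: eq_bigr => i _; rewrite mxE. Qed.

Lemma dotpC n (x y : 'cV[R]_n) : dotp x y = dotp y x.
Proof. by rewrite !dotpE; apply: eq_bigr => i _; rewrite mulrC. Qed.

Lemma dotpDl n (x y z : 'cV[R]_n) : dotp (x + y) z = dotp x z + dotp y z.
Proof. by rewrite /dotp linearD mulmxDl mxE. Qed.

Lemma dotpDr n (x y z : 'cV[R]_n) : dotp x (y + z) = dotp x y + dotp x z.
Proof. by rewrite /dotp mulmxDr mxE. Qed.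

Lemma dotpNl n (x y : 'cV[R]_n) : dotp (- x) y = - dotp x y.
Proof. by rewrite /dotp linearN mulNmx mxE. Qed.

Lemma dotpNr n (x y : 'cV[R]_n) : dotp x (- y) = - dotp x y.
Proof. by rewrite /dotp mulmxN mxE. Qed.

Lemma dotpZl n k (x y : 'cV[R]_n) : dotp (k *: x) y = k * dotp x y.
Proof. by rewrite /dotp linearZ -scalemxAl mxE. Qed.

Lemma dotpZr n k (x y : 'cV[R]_n) : dotp x (k *: y) = k * dotp x y.
Proof. by rewrite /dotp -scalemxAr mxE. Qed.

Lemma dotp0l n (x : 'cV[R]_n) : dotp 0 x = 0.
Proof. by rewrite -(scale0r 0) dotpZl mul0r. Qed.

Lemma dotp0r n (x : 'cV[R]_n) : dotp x 0 = 0.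
Proof. by rewrite dotpC dotp0l. Qed.

Lemma dotp_mulmx m n (A : 'M[R]_(m, n)) x y : dotp x (A *m y) =
  dotp (A^T *m x) y.
Proof. by rewrite /dotp trmx_mul trmxK mulmxA. Qed.

Lemma dotp_delta n (i : 'I_n) (y : 'cV[R]_n) : dotp (delta_mx i 0) y = y i 0.
Proof.
rewrite dotpE (bigD1 i)//= mxE !eqxx mul1r big1 ?addr0// => j ji.
by rewrite mxE (negPf ji) mul0r.
Qed.

Lemma dotp_bound n (x y : 'cV[R]_n) : `|dotp x y| <= n%:R * `|x| * `|y|.
Proof.
by rewrite -[`|x|]norm_trmx (le_trans _ (norm_mulmx _ _))// ler_mx_entry.
Qed.

End DotProduct.

Section BlockVectors.
Import tagnat.
Context {R : realType} {N : nat} {d : 'I_N -> nat}.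

(** For a flat index [t] the pair [sig1 t], [sig2 t] is well typed as it stands, which avoids
    casting [i] along [sig1 (Rank k i) = k]. *)
Lemma forall_sigP (Q : forall k, 'I_(d k) -> Prop) :
  (forall t : 'I_(\sum_k d k), Q (sig1 t) (sig2 t)) <-> forall k i, Q k i.
Proof.
split=> [H k i|//]; have := H (rank (Tagged (fun k => 'I_(d k)) i)).
by rewrite /sig1 /sig2 rankK.
Qed.

Lemma sum_sig (F : forall k, 'I_(d k) -> R) :
  \sum_(t : 'I_(\sum_k d k)) F (sig1 t) (sig2 t) = \sum_k \sum_i F k i.
Proof.
rewrite (sig_big_dep _ _ (fun k i => F k i))/= (reindex sig)/=;
  last exact: sig_bij_on.
by [].
Qed.

Lemma dotp_submxcol (x y : 'cV[R]_(\sum_k d k)) :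
  dotp x y = \sum_k dotp (submxcol x k) (submxcol y k).
Proof.
rewrite -(eq_bigr _ (fun k _ => esym (dotpE _ _))).
rewrite -(sum_sig (fun k i => (submxcol x k) i 0 * (submxcol y k) i 0)) dotpE.
by apply: eq_bigr => t _; rewrite !mxE !sig2K.
Qed.

Definition embed k (y : 'cV[R]_(d k)) : 'cV[R]_(\sum_k d k) :=
  \mxcol_i dfwith (fun j => 0 : 'cV[R]_(d j)) k y i.

Lemma submxcol_embed k (y : 'cV[R]_(d k)) : submxcol (embed y) k = y.
Proof. by rewrite mxcolK dfwithin. Qed.

Lemma submxcol_embed_neq k (y : 'cV[R]_(d k)) j :
  j != k -> submxcol (embed y) j = 0.
Proof. by move=> jk; rewrite mxcolK dfwithout// eq_sym. Qed.

Lemma dotp_embed k (y : 'cV[R]_(d k)) x : dotp (embed y) x =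
  dotp y (submxcol x k).
Proof.
rewrite dotp_submxcol (bigD1 k)//= submxcol_embed big1 ?addr0// => j jk.
by rewrite submxcol_embed_neq// dotp0l.
Qed.

Lemma embedZ k h (y : 'cV[R]_(d k)) : embed (h *: y) = h *: embed y.
Proof.
apply/mxcolP => j; rewrite -[RHS]/(submxcol (h *: embed y) j).
have -> : submxcol (h *: embed y) j = h *: submxcol (embed y) j.
  by apply/matrixP => a b; rewrite !mxE.
have [->|jk] := eqVneq j k; first by rewrite !submxcol_embed.
by rewrite !submxcol_embed_neq// scaler0.
Qed.

Lemma embed_delta k (j : 'I_(d k)) : embed (delta_mx j 0) =
  delta_mx (Rank k j) 0.
Proof.
apply/matrixP => a b; rewrite (ord1 b) -dotp_delta dotpC dotp_embed.
by rewrite dotp_delta !mxE eq_sym.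
Qed.

End BlockVectors.

Section FlatKKT.
Import tagnat.
Context {R : realType} {N : nat} (G : quadNEP R N).
Local Notation n := (\sum_(k < N) dimx G k)%N.
Local Notation m := (\sum_(k < N) dimu G k)%N.
Implicit Types (p : parameters G) (x : profile G) (l : multipliers G).

Lemma submxcolE (d : 'I_N -> nat) (x : 'cV[R]_(\sum_k d k)) k i :
  submxcol x k i 0 = x (Rank k i) 0.
Proof. by rewrite mxE. Qed.

(** Turns a unilateral deviation into an addition in the full space, where [dotp_quadraticD] expands
    the quadratic term. *)
Lemma deviate_embed x k (y : 'cV[R]_(dimx G k)) :
  deviate x (submxcol x k + y) = x + embed y.
Proof.
apply/mxcolP => j; rewrite mxcolK submxcolD.
have [->|jk] := eqVneq j k; first by rewrite dfwithin submxcol_embed.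
by rewrite dfwithout 1?eq_sym// submxcol_embed_neq// addr0.
Qed.

Lemma deviate_id x k : deviate x (submxcol x k) = x.
Proof.
rewrite -[submxcol x k]addr0 deviate_embed.
by rewrite -(scale0r 0) embedZ scale0r addr0.
Qed.

Lemma dotp_quadraticD q (P : 'M[R]_q) (x y : 'cV[R]_q) :
  dotp (x + y) (P *m (x + y)) =
  dotp x (P *m x) + dotp ((P + P^T) *m x) y + dotp y (P *m y).
Proof.
rewrite mulmxDr !dotpDl !dotpDr mulmxDl dotpDl -[dotp (P^T *m x) y]dotp_mulmx.
by rewrite [dotp y (P *m x)]dotpC; ring.
Qed.

(** Along a coordinate direction of player [k] the Lagrangian is a quadratic polynomial in the step
    [h]; the partial derivative is its linear coefficient. *)
Lemma grad_Lagrangian k x (l : 'cV[R]_(dimu G k)) w :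
  grad (fun y => Lagrangian (deviate x y) l w) (submxcol x k) =
  submxcol (2^-1 *: ((Pmat G k w + (Pmat G k w)^T) *m x) - cvec G k w) k
  + \sum_i l i 0 *: avec G k i w.
Proof.
apply/matrixP => j o; rewrite (ord1 o) {o} mxE.
pose E := delta_mx (Rank k j) 0 : 'cV[R]_n.
pose P := Pmat G k w.
apply: (@derive_quadratic _ _ _ _ _ _ (2^-1 * dotp E (P *m E))) => h.
rewrite addrC /Lagrangian deviate_embed embedZ embed_delta -/E deviate_id.
rewrite -/P dotp_quadraticD submxcolD [dotp (cvec _ _ _) _]dotpDr.
have -> : submxcol (h *: E) k = h *: delta_mx j 0.
  by rewrite /E -embed_delta -embedZ submxcol_embed.
have -> : \sum_i l i 0 * (dotp (avec G k i w) (submxcol x k + h *: delta_mx j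
  0) -
      bvec G k i 0) =
    \sum_i l i 0 * (dotp (avec G k i w) (submxcol x k) - bvec G k i 0) +
    h * (\sum_i l i 0 *: avec G k i w) j 0.
  rewrite summxE mulr_sumr -big_split; apply: eq_bigr => i _.
  by rewrite dotpDr dotpZr [dotp _ (delta_mx _ _)]dotpC dotp_delta mxE/=; ring.
have -> : (submxcol (2^-1 *: ((P + P^T) *m x) - cvec G k w) k +
    \sum_i l i 0 *: avec G k i w) j 0 =
    2^-1 * dotp ((P + P^T) *m x) E - dotp (cvec G k w) E +
    (\sum_i l i 0 *: avec G k i w) j 0.
  rewrite 2![dotp _ E]dotpC !dotp_delta [LHS]mxE submxcolE; congr (_ + _).
  by move: ((P + P^T) *m x) => u; rewrite !mxE.
by rewrite -scalemxAr !dotpZr dotpZl; ring.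
Qed.

(* P^k(w) need not be symmetric away from the reference parameter. *)
Definition hess p : 'M[R]_n := \matrix_(a, b)
  (2^-1 * (Pmat G (sig1 a) (par_w p (sig1 a)) a b +
           Pmat G (sig1 a) (par_w p (sig1 a)) b a)).

Definition lin p : 'cV[R]_n := \col_a cvec G (sig1 a) (par_w p (sig1 a)) a 0.

Definition normal p (t : 'I_m) : 'cV[R]_n :=
  embed (avec G (sig1 t) (sig2 t) (par_w p (sig1 t))).

Definition normals p : 'M[R]_(n, m) := \matrix_(a, t) normal p t a 0.

Definition slack p x (t : 'I_m) : R :=
  bvec G (sig1 t) (sig2 t) 0 + p.1.1 t 0 - dotp (normal p t) x.

Definition is_eq (t : 'I_m) := (sig2 t < n_eq G (sig1 t))%N.

Lemma submxcol_normals p l k :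
  submxcol (normals p *m l) k =
  \sum_i submxcol l k i 0 *: avec G k i (par_w p k).
Proof.
apply/matrixP => j o; rewrite (ord1 o) {o} submxcolE mxE summxE.
transitivity (\sum_t submxcol l (sig1 t) (sig2 t) 0 *
   submxcol (embed (avec G (sig1 t) (sig2 t) (par_w p (sig1 t)))) k j 0).
  by apply: eq_bigr => t _; rewrite !submxcolE sig2K mxE mulrC.
rewrite (sum_sig (fun k' i => submxcol l k' i 0 *
   submxcol (embed (avec G k' i (par_w p k'))) k j 0)).
rewrite (bigD1 k)//= [X in _ + X]big1 ?addr0 => [|k' k'k].
  by apply: eq_bigr => i _; rewrite submxcol_embed [RHS]mxE.
by apply: big1 => i _; rewrite submxcol_embed_neq 1?eq_sym//
  [X in _ * X]mxE mulr0.
Qed.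

(** The gradients of all players stack up to one affine map, because row [a] of [hess p] and of
    [lin p] is taken from the player [sig1 a] owning that coordinate. *)
Lemma grad_LagrangianE p x l k :
  grad (fun y => Lagrangian (deviate x y) (submxcol l k) (par_w p k)) (submxcol
    x k)
  = submxcol (hess p *m x - lin p + normals p *m l) k.
Proof.
rewrite grad_Lagrangian [RHS]submxcolD submxcol_normals; congr (_ + _).
apply/matrixP => j o; rewrite (ord1 o) {o} !submxcolE !mxE Rank1K.
congr (_ - _); rewrite mulr_sumr; apply: eq_bigr => b _.
by rewrite !mxE Rank1K mulrA.
Qed.

Definition flat_KKT p x l :=
  p.1.2 = hess p *m x - lin p + normals p *m l /\
  forall t, if is_eq t then slack p x t = 0
    else [/\ 0 <= l t 0, 0 <= slack p x t & l t 0 * slack p x t = 0].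

(** The slack is [u - g], so each constraint condition is preserved, the complementarity product
    only changing its sign. *)
Lemma S_KKT_flat p x l : S_KKT p (x, l) <-> flat_KKT p x l.
Proof.
have gE t : dotp (avec G (sig1 t) (sig2 t) (par_w p (sig1 t))) (submxcol x
  (sig1 t))
    - bvec G (sig1 t) (sig2 t) 0 = submxcol p.1.1 (sig1 t) (sig2 t) 0 - slack p
      x t.
  by rewrite submxcolE sig2K /slack dotp_embed; ring.
split=> [H|[H1 H2]].
  split=> [|t].
    by apply/mxcolP => k; rewrite -grad_LagrangianE; have [] := H k.
  have [_ /(_ (sig2 t))] := H (sig1 t); rewrite /is_eq /par_u /= gE.
  rewrite [submxcol l _ _ _]submxcolE sig2K; case: ifP => _; first by lra.
  move=> [l0 s0 ls]; split=> //; first by lra.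
  by rewrite -[RHS]oppr0 -[in RHS]ls; ring.
move=> k /=; split; first by rewrite grad_LagrangianE -H1.
move: k; apply/forall_sigP => t; have := H2 t; rewrite /is_eq /par_u gE.
rewrite [submxcol l _ _ _]submxcolE sig2K; case: ifP => _; first by lra.
move=> [l0 s0 ls]; split=> //; first by lra.
by rewrite -[RHS]oppr0 -[in RHS]ls; ring.
Qed.

End FlatKKT.

(** * Calculus of locally Lipschitz maps *)

Lemma lip_near_nonexp {R : realType} (V W : normedModType R) (g : V -> W) a :
  (forall x y, `|g x - g y| <= `|x - y|) -> lip_near g a.
Proof.
move=> gL; exists 1, setT; split=> //; first exact: filterT.
by move=> x y _ _; rewrite mul1r.
Qed.

Section LipschitzCalculus.
Import tagnat.
Context {R : realType} {V : normedModType R}.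

Lemma lip_near_fst (W1 W2 : normedModType R) (f : V -> W1 * W2) a :
  lip_near f a -> lip_near (fun x => (f x).1) a.
Proof.
move=> fL; apply: (lip_near_comp (f := fst) fL); apply: lip_near_nonexp => x y.
by rewrite [leRHS]prod_normE le_max lexx.
Qed.

Lemma lip_near_snd (W1 W2 : normedModType R) (f : V -> W1 * W2) a :
  lip_near f a -> lip_near (fun x => (f x).2) a.
Proof.
move=> fL; apply: (lip_near_comp (f := snd) fL); apply: lip_near_nonexp => x y.
by rewrite [leRHS]prod_normE le_max lexx orbT.
Qed.

Lemma lip_near_id a : lip_near (@id V) a.
Proof. exact: lip_near_nonexp. Qed.

Lemma lip_near_matrix m n (F : V -> 'I_m -> 'I_n -> R) a :
  (forall i j, lip_near (fun x => F x i j : R^o) a) ->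
  lip_near (fun x => \matrix_(i, j) F x i j) a.
Proof.
by move=> FL; apply: lip_near_mx => i j; under eq_fun do rewrite mxE; exact: FL.
Qed.

Lemma lip_near_submxcol N (d : 'I_N -> nat) (f : V -> 'cV[R]_(\sum_i d i)) k a :
  lip_near f a -> lip_near (fun x => submxcol (f x) k) a.
Proof.
move=> fL; apply: (lip_near_comp (f := fun y => submxcol y k) fL).
apply: lip_near_nonexp => x y; rewrite -submxcolB.
by apply/ler_mx_normP => // i j; rewrite mxE ler_mx_entry.
Qed.

Lemma lip_near_embed N (d : 'I_N -> nat) k (f : V -> 'cV[R]_(d k)) a :
  lip_near f a -> lip_near (fun x => embed (f x)) a.
Proof.
move=> fL; apply: lip_near_mx => i j; rewrite (ord1 j) {j}.
rewrite (_ : (fun x => _) = fun x => submxcol (embed (f x)) (sig1 i) (sig2 i)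
  0).
  move: (sig1 i) (sig2 i) => k' {}i; have [E|kk'] := eqVneq k' k.
    move: i; rewrite E => i.
    by under eq_fun do rewrite submxcol_embed; exact: lip_near_entry.
  by under eq_fun do rewrite submxcol_embed_neq// mxE; exact: lip_near_cst.
by apply/funext => x; rewrite submxcolE sig2K.
Qed.

Lemma lip_near_block_mx m1 m2 n1 n2 (A : V -> 'M[R]_(m1, n1))
    (B : V -> 'M[R]_(m1, n2)) (C : V -> 'M[R]_(m2, n1)) (D : V ->
      'M[R]_(m2, n2)) a :
  lip_near A a -> lip_near B a -> lip_near C a -> lip_near D a ->
  lip_near (fun x => block_mx (A x) (B x) (C x) (D x)) a.
Proof.
move=> AL BL CL DL; apply: lip_near_mx => i j.
case: (split_ordP i) => i' ->; case: (split_ordP j) => j' ->.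
- by under eq_fun do rewrite block_mxEul; exact: lip_near_entry.
- by under eq_fun do rewrite block_mxEur; exact: lip_near_entry.
- by under eq_fun do rewrite block_mxEdl; exact: lip_near_entry.
- by under eq_fun do rewrite block_mxEdr; exact: lip_near_entry.
Qed.

Lemma lip_near_col_mx m1 m2 n (A : V -> 'M[R]_(m1, n)) (B : V ->
  'M[R]_(m2, n)) a :
  lip_near A a -> lip_near B a -> lip_near (fun x => col_mx (A x) (B x)) a.
Proof.
move=> AL BL; apply: lip_near_mx => i j; case: (split_ordP i) => i' ->.
- by under eq_fun do rewrite col_mxEu; exact: lip_near_entry.
- by under eq_fun do rewrite col_mxEd; exact: lip_near_entry.
Qed.

Lemma lip_nearM (f g : V -> R^o) a :
  lip_near f a -> lip_near g a -> lip_near (fun x => f x * g x : R^o) a.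
Proof.
move=> fL gL; have [C [U [C0 aU fU]]] := fL; have [D [W [D0 aW gW]]] := gL.
(* A product of Lipschitz functions is Lipschitz where both are bounded; [B] bounds them where they
   differ by less than 1 from their values at [a]. *)
pose B := `|f a| + `|g a| + 1.
have B0 : 0 <= B by rewrite !addr_ge0.
exists (B * (C + D)), (U `&` W `&` [set x | `|f x| <= B /\ `|g x| <= B]); split.
- by rewrite mulr_ge0// addr_ge0.
- apply: filterI; first exact: filterI.
  near=> x; rewrite /=.
  have f1 : `|f x - f a| < 1 by near: x; exact: lip_near_dist fL _.
  have g1 : `|g x - g a| < 1 by near: x; exact: lip_near_dist gL _.
  have := ler_normD (f x - f a) (f a); have := ler_normD (g x - g a) (g a).
  rewrite !subrK /B => gx fx.
  have := normr_ge0 (f a); have := normr_ge0 (g a).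
  by move: (`|f a|) (`|g a|) fx gx f1 g1 => *; split; lra.
move=> x y [[Ux Wx] [fx gx]] [[Uy Wy] [fy gy]].
have -> : f x * g x - f y * g y = f x * (g x - g y) + g y * (f x - f y) by ring.
rewrite (le_trans (ler_normD _ _))// !normrM addrC mulrDr mulrDl.
by rewrite -!mulrA lerD// ler_pM ?fU ?gW.
Unshelve. all: by end_near. Qed.

Lemma lip_near_sum (I : finType) (f : I -> V -> R^o) a :
  (forall i, lip_near (f i) a) -> lip_near (fun x => \sum_i f i x : R^o) a.
Proof.
move=> fL; elim: (index_enum I) => [|i s IH].
  by under eq_fun do rewrite big_nil; exact: lip_near_cst.
by under eq_fun do rewrite big_cons; exact: lip_nearD.
Qed.

Lemma lip_near_dotp n (f g : V -> 'cV[R]_n) a :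
  lip_near f a -> lip_near g a -> lip_near (fun x => dotp (f x) (g x) : R^o) a.
Proof.
move=> fL gL; under eq_fun do rewrite dotpE.
by apply: lip_near_sum => i; apply: lip_nearM; exact: lip_near_entry.
Qed.

Lemma lip_near_continuous (W : normedModType R) (f : V -> W) :
  (forall a, lip_near f a) -> continuous f.
Proof.
move=> fL a; apply/(@cvgrPdist_lt _ _ _ (nbhs a)) => e e_gt0; near=> x.
by rewrite distrC; near: x; exact: lip_near_dist (fL a) _.
Unshelve. all: by end_near. Qed.

Lemma lip_near_norm (W : normedModType R) (f : V -> W) a :
  lip_near f a -> lip_near (fun x => `|f x| : R^o) a.
Proof.
move=> fL; apply: (lip_near_comp (f := fun y => `|y| : R^o) fL).
by apply: lip_near_nonexp => x y; exact: ler_dist_dist.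
Qed.

Lemma lip_near_mulmx m n p (A : V -> 'M[R]_(m, n)) (B : V -> 'M[R]_(n, p)) a :
  lip_near A a -> lip_near B a -> lip_near (fun x => A x *m B x) a.
Proof.
move=> AL BL; apply: lip_near_mx => i j; under eq_fun do rewrite mxE.
apply: lip_near_sum => k.
by apply: lip_nearM; exact: lip_near_entry.
Qed.

End LipschitzCalculus.

(** * The KKT system near the reference point as a mixed complementarity problem *)

Section LocalizedKKT.
Import tagnat.
Context {R : realType} {N : nat} (G : quadNEP R N).
Local Notation n := (\sum_(k < N) dimx G k)%N.
Local Notation m := (\sum_(k < N) dimu G k)%N.
Implicit Types (p : parameters G) (x : profile G) (l : multipliers G).
Variables (xbar : profile G) (lbar : multipliers G).

Definition in_I1 (t : 'I_m) := sig2 t \in I1 xbar lbar (sig1 t).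
Definition in_I2 (t : 'I_m) := sig2 t \in I2 xbar lbar (sig1 t).
Definition in_I12 (t : 'I_m) := in_I1 t || in_I2 t.

Lemma active_slack t : active xbar (sig2 t) = (slack 0 xbar t == 0).
Proof.
rewrite /active /slack /normal dotp_embed /par_w submxcol0 /= mxE addr0.
by rewrite -/(abar (sig2 t)) -oppr_eq0 opprB.
Qed.

Lemma in_I1E t : in_I1 t = is_eq t || (0 < lbar t 0) && (slack 0 xbar t == 0).
Proof. by rewrite /in_I1 inE submxcolE sig2K active_slack. Qed.

Lemma in_I2E t :
  in_I2 t = [&& ~~ is_eq t, lbar t 0 == 0 & slack 0 xbar t == 0].
Proof. by rewrite /in_I2 inE submxcolE sig2K active_slack -leqNgt. Qed.

(* The complementarity of the constraints in I2 is kept, those in I1 are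
   equations, and the multipliers of the remaining constraints vanish. *)
Definition loc_matrix p : 'M[R]_(n + m) := block_mx
  (hess p) (normals p)
  (\matrix_(t, a) if in_I12 t then - normal p t a 0 else 0)
  (\matrix_(t, t') if in_I12 t then 0 else (t == t')%:R).

Definition loc_vector p : 'cV[R]_(n + m) := col_mx
  (- lin p - p.1.2)
  (\col_t if in_I12 t then bvec G (sig1 t) (sig2 t) 0 + p.1.1 t 0 else 0).

Definition loc_index : {set 'I_(n + m)} := 
  [set i : 'I_(n + m) | if fintype.split i is inr t then in_I2 t else
    false]%SET.

Lemma loc_index_lshift a : (lshift m a \in loc_index) = false.
Proof. by rewrite inE (unsplitK (inl a)). Qed.

Lemma loc_index_rshift t : (rshift n t \in loc_index) = in_I2 t.
Proof. by rewrite inE (unsplitK (inr t)). Qed.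

Lemma loc_matrixE p x l : loc_matrix p *m col_mx x l =
  col_mx (hess p *m x + normals p *m l)
    (\col_t if in_I12 t then - dotp (normal p t) x else l t 0).
Proof.
rewrite mul_block_col; congr col_mx; apply/matrixP => t o; rewrite (ord1 o) {o}.
rewrite [RHS]mxE [LHS]mxE [X in X + _]mxE [X in _ + X]mxE.
case: ifP => t12.
  rewrite [X in _ + X]big1 ?addr0 => [|t' _]; last by rewrite mxE t12 mul0r.
  rewrite dotpE -sumrN; apply: eq_bigr => a _.
  by rewrite [X in X * _]mxE t12 mulNr.
rewrite big1 ?add0r => [|a _]; last by rewrite mxE t12 mul0r.
rewrite (bigD1 t)//= mxE t12 eqxx mul1r [X in _ + X]big1 ?addr0// => t' t't.
by rewrite mxE t12 eq_sym (negPf t't) mul0r.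
Qed.

Definition loc_KKT p x l :=
  p.1.2 = hess p *m x - lin p + normals p *m l /\
  forall t, if in_I2 t
    then [/\ 0 <= l t 0, 0 <= slack p x t & l t 0 * slack p x t = 0]
    else if in_I1 t then slack p x t = 0 else l t 0 = 0.

(** In the lower rows the residual is the slack for constraints in [in_I12] and the multiplier
    otherwise; the unknown paired with row [t] is [l t 0], so the rows of [in_I2] express
    complementarity. *)
Lemma mlcp_loc_KKT p x l :
  mlcp (loc_matrix p) (loc_vector p) loc_index (col_mx x l) <-> loc_KKT p x l.
Proof.
have rowE : loc_matrix p *m col_mx x l + loc_vector p =
    col_mx (hess p *m x - lin p + normals p *m l - p.1.2)
      (\col_t if in_I12 t then slack p x t else l t 0).
  rewrite loc_matrixE add_col_mx; congr col_mx.
    by rewrite addrA [X in X - p.1.2 = _]addrAC.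
  apply/matrixP => t o; rewrite (ord1 o) !mxE; case: ifP => _;
    last by rewrite addr0.
  by rewrite /slack addrC.
have slackE t : (\col_t (if in_I12 t then slack p x t else l t 0)) t 0 =
    if in_I12 t then slack p x t else l t 0 by rewrite mxE.
split=> [H|[H1 H2] i].
  split=> [|t].
    apply/esym/eqP; rewrite -subr_eq0; apply/eqP/matrixP => a o.
    have := H (lshift m a); rewrite (ord1 o) loc_index_lshift rowE col_mxEu =>
      ->.
    by rewrite mxE.
  have := H (rshift n t); rewrite loc_index_rshift rowE !col_mxEd slackE
    /in_I12.
  by case: in_I2; case: in_I1.
rewrite rowE; case: (split_ordP i) => [a|t] ->.
  by rewrite loc_index_lshift col_mxEu H1 subrr mxE.
rewrite loc_index_rshift !col_mxEd slackE /in_I12; have := H2 t.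
by case: in_I2; case: in_I1.
Qed.

Hypothesis KKTbar : flat_KKT 0 xbar lbar.

(** The strict inequalities at the reference point whose persistence keeps the classification of the
    constraints valid. *)
Definition same_signs p x l := forall t,
  (~~ is_eq t -> 0 < lbar t 0 -> 0 < l t 0) /\
  (0 < slack 0 xbar t -> 0 < slack p x t).

(** A multiplier that stays positive forces its slack to vanish, and a slack that stays positive
    forces its multiplier to vanish. Equalities and the constraints of [in_I2] have the same
    condition on both sides. *)
Lemma flat_KKT_loc p x l : same_signs p x l -> flat_KKT p x l <-> loc_KKT p x l.
Proof.
move=> signs; rewrite /flat_KKT /loc_KKT.
suff H t : (if is_eq t then slack p x t = 0
    else [/\ 0 <= l t 0, 0 <= slack p x t & l t 0 * slack p x t = 0]) <->
  if in_I2 t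
    then [/\ 0 <= l t 0, 0 <= slack p x t & l t 0 * slack p x t = 0]
    else if in_I1 t then slack p x t = 0 else l t 0 = 0.
  by split=> -[? HH]; split=> // t; apply/H; exact: HH.
rewrite in_I1E in_I2E; have := KKTbar.2 t; have [] := signs t.
case: is_eq => //= /(_ isT) lpos spos [l0 s0 ls].
have [lt0|l_le0] := ltP 0 (lbar t 0).
  have l_gt0 := lpos lt0.
  move/eqP: ls; rewrite mulf_eq0 (gt_eqF lt0)/= => ->.
  split=> [[_ _ /eqP]|->]; first by rewrite mulf_eq0 (gt_eqF l_gt0) => /eqP.
  by rewrite mulr0 ltW.
have -> : lbar t 0 == 0 by rewrite eq_le l0 l_le0.
have [//|s_neq0] := eqVneq (slack 0 xbar t) 0.
have s_gt0 : 0 < slack p x t by apply: spos; rewrite lt_def s_neq0.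
split=> [[_ _ /eqP]|->]; first by rewrite mulf_eq0 (gt_eqF s_gt0) orbF => /eqP.
by rewrite mul0r lexx ltW.
Qed.

Hypotheses (P_C1 : forall k, C1_around (Pmat G k) 0)
  (c_C1 : forall k, C1_around (cvec G k) 0)
  (a_C1 : forall k (i : 'I_(dimu G k)), C1_around (avec G k i) 0).

Lemma lip_near_par_w (W : normedModType R) k (f : 'cV[R]_(dimw G k) -> W) :
  lip_near f 0 -> lip_near (fun p => f (par_w p k)) 0.
Proof.
move=> fL; apply: (@lip_near_comp _ _ _ _ (fun p => par_w p k)).
  apply: lip_near_submxcol; apply: lip_near_snd; exact: lip_near_id.
by rewrite /par_w submxcol0.
Qed.

Lemma lip_near_hess : lip_near (@hess _ _ G) 0.
Proof.
rewrite /hess; apply: lip_near_matrix => a b.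
apply: (@lip_nearZ _ _ R^o); apply: lip_nearD; apply: lip_near_entry;
  apply: lip_near_par_w; exact: C1_around_lip_near.
Qed.

Lemma lip_near_normal t : lip_near (fun p => normal p t) 0.
Proof.
apply: lip_near_embed; apply: (@lip_near_par_w _ _ (avec G (sig1 t) (sig2 t))).
exact: C1_around_lip_near.
Qed.

Lemma lip_near_u t : lip_near (fun p => p.1.1 t 0 : R^o) 0.
Proof.
apply: lip_near_entry; do 2 apply: lip_near_fst; exact: lip_near_id.
Qed.

Lemma lip_near_loc_matrix : lip_near loc_matrix 0.
Proof.
apply: lip_near_block_mx; first exact: lip_near_hess.
- apply: lip_near_matrix => a t.
  by apply: lip_near_entry; exact: lip_near_normal.
- apply: lip_near_matrix => t a.
  case: in_I12; last exact: lip_near_cst.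
  by apply: lip_nearN; apply: lip_near_entry; exact: lip_near_normal.
- exact: lip_near_cst.
Qed.

Lemma lip_near_loc_vector : lip_near loc_vector 0.
Proof.
apply: lip_near_col_mx.
  apply: lip_nearD; apply: lip_nearN; last first.
    by apply: lip_near_snd; apply: lip_near_fst; exact: lip_near_id.
  apply: lip_near_matrix => a b.
  by apply: lip_near_entry; apply: lip_near_par_w; exact: C1_around_lip_near.
apply: lip_near_matrix => t b.
case: in_I12; last exact: lip_near_cst.
by apply: lip_nearD; [exact: lip_near_cst|exact: lip_near_u].
Qed.

(** Finitely many strict inequalities between functions that are continuous at the reference
    point. *)
Lemma same_signs_near : \forall z \near ((0 : parameters G), (xbar, lbar)),
  same_signs z.1 z.2.1 z.2.2.
Proof.
pose ok t (z : parameters G * (profile G * multipliers G)) :=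
  (~~ is_eq t -> 0 < lbar t 0 -> 0 < z.2.2 t 0) /\
  (0 < slack 0 xbar t -> 0 < slack z.1 z.2.1 t).
have signs t : \forall z \near ((0 : parameters G), (xbar, lbar)), ok t z;
  last first.
  by apply: filterS (filter_forall (f := ok) _ signs) => z.
have nW (P : set (parameters G * (profile G * multipliers G))) :
  (forall z, P z) -> nbhs ((0 : parameters G), (xbar, lbar)) P.
  by move=> PT; rewrite (_ : P = setT); [exact: filterT|apply/seteqP; split].
rewrite /ok; apply: filterI => /=.
  case: (boolP (is_eq t)) => [_|_]; first by apply: nW => z.
  have [l_gt0|l_le0] := ltP 0 (lbar t 0); last by apply: nW => z.
  have lL : lip_near (fun z : parameters G * (profile G * multipliers G) =>
      z.2.2 t 0 : R^o) (0, (xbar, lbar)).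
    by apply: lip_near_entry; do 2 apply: lip_near_snd; exact: lip_near_id.
  near=> z => _ _.
  have : `|z.2.2 t 0 - lbar t 0| < lbar t 0 by near: z;
    exact: (lip_near_dist lL).
  by rewrite ltr_distl subrr => /andP[].
have [s_gt0|s_le0] := ltP 0 (slack 0 xbar t); last by apply: nW => z.
have sL : lip_near (fun z : parameters G * (profile G * multipliers G) =>
    slack z.1 z.2.1 t : R^o) (0, (xbar, lbar)).
  have pL : lip_near (fun z : parameters G * (profile G * multipliers G) => z.1)
    (0, (xbar, lbar)) by apply: lip_near_fst; exact: lip_near_id.
  apply: lip_nearD; last apply: lip_nearN.
    apply: lip_nearD; first exact: lip_near_cst.
    exact: (lip_near_comp pL (lip_near_u t)).
  apply: lip_near_dotp; first exact: (lip_near_comp pL (lip_near_normal t)).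
  by apply: lip_near_fst; apply: lip_near_snd; exact: lip_near_id.
near=> z => _.
have : `|slack z.1 z.2.1 t - slack 0 xbar t| < slack 0 xbar t.
  by near: z; exact: (lip_near_dist sL).
by rewrite ltr_distl subrr => /andP[].
Unshelve. all: by end_near. Qed.

End LocalizedKKT.

(** * The P-property at the reference point *)

Section QuadraticForms.
Context {R : realType}.

(** The expression is [alpha] times the form of [H] at [z + (2 * alpha)^-1 *: (invmx H *m s)]. *)
Lemma completed_square_ge0 r (H : 'M[R]_r) (alpha : R) (s z : 'cV[R]_r) :
  H^T = H -> (forall u, u != 0 -> 0 < dotp u (H *m u)) -> 0 < alpha ->
  0 <= (4 * alpha)^-1 * dotp s (invmx H *m s) + alpha * dotp z (H *m z) + dotp
    s z.
Proof.
move=> Hsym Hpos alpha_gt0.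
have Hunit : H \in unitmx.
  rewrite -row_free_unit -kermx_eq0; apply/rowV0P => v /sub_kermxP vH.
  apply: trmx_inj; rewrite trmx0; apply/eqP; apply: contraT => /Hpos.
  by rewrite /dotp trmxK mulmxA vH mul0mx mxE ltxx.
pose u := z + (2 * alpha)^-1 *: (invmx H *m s).
have u_ge0 : 0 <= dotp u (H *m u).
  by have [->|/Hpos/ltW//] := eqVneq u 0; rewrite dotp0l.
have Hu : H *m u = H *m z + (2 * alpha)^-1 *: s.
  by rewrite mulmxDr -scalemxAr mulKVmx.
move: u_ge0; rewrite Hu dotpDr !dotpDl !dotpZl !dotpZr.
rewrite [dotp (invmx H *m s) (H *m z)]dotp_mulmx Hsym mulKVmx//.
rewrite [dotp z s]dotpC [dotp (_ *m _) s]dotpC => /(mulr_ge0 (ltW alpha_gt0)).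
congr (_ <= _); field; exact: lt0r_neq0.
Qed.

End QuadraticForms.

Lemma submxcol_mulmx (R : realType) N (d : 'I_N -> nat)
    (P : 'M[R]_(\sum_k d k)) (x : 'cV[R]_(\sum_k d k)) k :
  submxcol (P *m x) k = \sum_i submxblock P k i *m submxcol x i.
Proof.
rewrite -submxcol_mul -[submxcol P k]submxrowK -[X in _ *m X]submxcolK.
by rewrite mul_mxrow_mxcol; apply: eq_bigr => i _; rewrite submxblockEv.
Qed.

Section ReferencePoint.
Import tagnat.
Context {R : realType} {N : nat} (G : quadNEP R N).
Local Notation n := (\sum_(k < N) dimx G k)%N.
Local Notation m := (\sum_(k < N) dimu G k)%N.
Variables (xbar : profile G) (lbar : multipliers G).
Hypothesis P_sym : forall k, (Pmat G k 0)^T = Pmat G k 0.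

(** At the reference point symmetry of each [Pmat G k 0] undoes the averaging in [hess]. *)
Lemma submxcol_hess0 (x : profile G) k :
  submxcol (hess 0 *m x) k = \sum_i Pblock G k k i *m submxcol x i.
Proof.
transitivity (submxcol (Pmat G k 0 *m x) k).
  apply/matrixP => j o; rewrite (ord1 o) !submxcolE !mxE; apply: eq_bigr => b _.
  rewrite mxE Rank1K /par_w submxcol0 -[in X in _ + X]P_sym mxE.
  by congr (_ * _); field.
exact: submxcol_mulmx.
Qed.

Variables (r : 'I_N -> nat) (B : forall k, 'M[R]_(dimx G k, r k)).
Hypotheses
  (B_basis : forall k, is_col_basis (B k) (Mspace xbar lbar k))
  (H2 : forall k (y : 'cV[R]_(dimx G k)), y != 0 -> Mspace xbar lbar k y ->
     0 < dotp y (Pblock G k k k *m y)).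

Lemma Pblock_sym k : (Pblock G k k k)^T = Pblock G k k k.
Proof. by rewrite /Pblock tr_submxblock P_sym. Qed.

Lemma Tmat_tr i k : (Tmat G i k)^T = Tmat G k i.
Proof. by rewrite /Tmat linearD/= trmxK addrC. Qed.

(** The columns of [B k] are independent, so [B k *m z] is a nonzero element of [Mspace] and
    condition (ii) applies. *)
Lemma reduced_block_pos k (z : 'cV[R]_(r k)) : z != 0 ->
  0 < dotp z ((B k)^T *m Pblock G k k k *m B k *m z).
Proof.
move=> z_neq0; have [B_free B_span] := B_basis k.
rewrite -!mulmxA dotp_mulmx trmxK; apply: H2; last by apply/B_span; exists z.
apply: contra_neq z_neq0 => Bz; apply: trmx_inj; apply: (row_free_inj B_free).
by rewrite -trmx_mul Bz !trmx0 mul0mx.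
Qed.

(** Write [x = B i *m z]. Multiplied by [alpha k i], condition (iii) says that the [y] term exceeds
    [(4 * alpha i k)^-1] times the form of [invmx Hi] at [s]. This is what the completed square in
    [z] with weight [alpha i k] requires, the cross term being [dotp s z]. *)
Lemma pair_form_gt0 (alpha : 'I_N -> 'I_N -> R) i k
    (y : 'cV[R]_(dimx G k)) (x : 'cV[R]_(dimx G i)) :
  0 < alpha i k -> 0 < alpha k i -> Mspace xbar lbar i x ->
  0 < dotp y ((Pblock G k k k
     - (4 * alpha i k * alpha k i)^-1 *:
       ((Tmat G i k)^T *m B i
        *m invmx ((B i)^T *m Pblock G i i i *m B i)
        *m (B i)^T *m Tmat G i k)) *m y) ->
  0 < alpha k i * dotp y (Pblock G k k k *m y)
    + alpha i k * dotp x (Pblock G i i i *m x) + dotp y (Tmat G k i *m x).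
Proof.
move=> aik aki Mx; have [_ /(_ x)[/(_ Mx)[z xE] _]] := B_basis i.
pose Hi := (B i)^T *m Pblock G i i i *m B i.
pose s := (B i)^T *m (Tmat G i k *m y).
rewrite mulmxBl -scalemxAl dotpDr dotpNr dotpZr.
have -> : dotp y ((Tmat G i k)^T *m B i *m invmx Hi *m (B i)^T *m Tmat G i k *m
  y)
    = dotp s (invmx Hi *m s).
  by rewrite -!mulmxA dotp_mulmx trmxK dotp_mulmx.
have Hsym : Hi^T = Hi by rewrite /Hi !trmx_mul trmxK Pblock_sym mulmxA.
have := completed_square_ge0 s z Hsym (@reduced_block_pos i) aik.
have -> : dotp z (Hi *m z) = dotp x (Pblock G i i i *m x).
  by rewrite xE /Hi -!mulmxA dotp_mulmx trmxK.
have -> : dotp s z = dotp y (Tmat G k i *m x).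
  by rewrite dotp_mulmx Tmat_tr xE dotp_mulmx.
move: (dotp s _) => c sq; rewrite subr_gt0 -(ltr_pM2l aki).
have -> : alpha k i * ((4 * alpha i k * alpha k i)^-1 * c) =
  (4 * alpha i k)^-1 * c.
  by field; rewrite !lt0r_neq0.
lra.
Qed.


Hypothesis H3 : exists alpha : 'I_N -> 'I_N -> R,
  [/\ forall i j, j != i -> 0 < alpha i j,
      forall i, \sum_(j | j != i) alpha i j = 1 &
      forall i k, i != k ->
      forall y : 'cV[R]_(dimx G k), y != 0 -> Mspace xbar lbar k y ->
        0 < dotp y ((Pblock G k k k
          - (4 * alpha i k * alpha k i)^-1 *:
            ((Tmat G i k)^T *m B i
             *m invmx ((B i)^T *m Pblock G i i i *m B i)
             *m (B i)^T *m Tmat G i k)) *m y)].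

(* Since the weights alpha k i sum to 1 over i, twice the form is the sum over
   ordered pairs (k, i) of the two-player forms of [pair_form_gt0]. *)
Lemma hess0_pos (x : profile G) : x != 0 ->
  (forall k, Mspace xbar lbar k (submxcol x k)) -> 0 < dotp x (hess 0 *m x).
Proof.
move=> x_neq0 xM; have [alpha [alpha_gt0 alpha_sum Hpair]] := H3.
pose t k i := dotp (submxcol x k) (Pblock G k k i *m submxcol x i).
pose D k i := alpha k i * t k k + alpha i k * t i i + (t k i + t i k).
have QE : dotp x (hess 0 *m x) = \sum_k \sum_i t k i.
  rewrite dotp_submxcol; apply: eq_bigr => k _; rewrite submxcol_hess0.
  by rewrite /dotp mulmx_sumr summxE.
have DE k i : D k i = alpha k i * t k k + alpha i k * t i i +
    dotp (submxcol x k) (Tmat G k i *m submxcol x i).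
  rewrite /D; congr (_ + _); rewrite /t /Tmat mulmxDl dotpDr; congr (_ + _).
  by rewrite [RHS]dotp_mulmx trmxK dotpC.
have swap (F : 'I_N -> 'I_N -> R) :
    \sum_k \sum_(i | i != k) F i k = \sum_k \sum_(i | i != k) F k i.
  rewrite (exchange_big_dep predT)//=; apply: eq_bigr => k _.
  by apply: eq_bigl => i; rewrite eq_sym.
have QD : 2 * dotp x (hess 0 *m x) = \sum_k \sum_(i | i != k) D k i.
  rewrite QE; have -> : \sum_k \sum_i t k i = \sum_k t k k + \sum_k \sum_(i | i
    != k) t k i.
    by rewrite -big_split; apply: eq_bigr => k _; rewrite (bigD1 k).
  have -> : \sum_k t k k = \sum_k \sum_(i | i != k) alpha k i * t k k.
    by apply: eq_bigr => k _; rewrite -mulr_suml alpha_sum mul1r.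
  under [RHS]eq_bigr => k _ do rewrite !big_split/=.
  rewrite !big_split/= (swap (fun k i => alpha k i * t k k)) (swap t).
  by ring.
have Dpos k i : i != k -> submxcol x k != 0 -> 0 < D k i.
  move=> ik xk; rewrite DE; apply: pair_form_gt0; rewrite ?alpha_gt0//.
    by rewrite eq_sym.
  exact: Hpair.
(* If player [k] has zero block, only [alpha i k * t i i] remains, which is nonnegative by (ii). *)
have D_ge0 k i : i != k -> 0 <= D k i.
  move=> ik; have [xk|/(Dpos _ _ ik)/ltW//] := eqVneq (submxcol x k) 0.
  have ti : 0 <= t i i.
    rewrite /t; have [->|xi] := eqVneq (submxcol x i) 0;
      first by rewrite dotp0l.
    by rewrite ltW// H2.
  rewrite DE /t xk !dotp0l mulr0 add0r addr0 mulr_ge0// ltW// alpha_gt0//.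
  by rewrite eq_sym.
have [k xk] : exists k, submxcol x k != 0.
  apply/existsP; apply: contra_neqT x_neq0 => /existsPn xk0; apply/mxcolP => k.
  by rewrite submxcol0; apply/eqP; rewrite -[_ == _]negbK.
(* A second player exists: otherwise the weights of [k] would have the empty sum 0 instead of 1. *)
have [i ik] : exists i, i != k.
  apply/existsP; apply: contraT => /existsPn noi; have := alpha_sum k.
  rewrite big1 => [/eqP|i]; first by rewrite eq_sym oner_eq0.
  by rewrite (negPf (noi i)).
suff : 0 < 2 * dotp x (hess 0 *m x) by rewrite pmulr_rgt0.
rewrite QD (bigD1 k)//= (bigD1 i)//= -addrA ltr_wpDr ?Dpos//.
rewrite addr_ge0// sumr_ge0// => j; first by case/andP => /D_ge0.
by move=> _; rewrite sumr_ge0// => i' /D_ge0.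
Qed.

Hypothesis H1 : forall k, row_free (col_mx (Amat (I1 xbar lbar k))
                                           (Amat (I2 xbar lbar k))).

(** Player by player, a vanishing combination of the normals in [I1] and [I2] is a vanishing
    combination of the rows in condition (i). *)
Lemma normals0_inj (l : multipliers G) :
  (forall t, ~~ in_I12 xbar lbar t -> l t 0 = 0) -> normals 0 *m l = 0 -> l = 0.
Proof.
move=> l_out nl; apply/mxcolP => k; rewrite submxcol0.
pose lk := submxcol l k.
have {l_out} lk_out i : i \notin I1 xbar lbar k -> i \notin I2 xbar lbar k ->
  lk i 0 = 0.
  move=> i1 i2; move: k i @lk i1 i2.
  apply/(@forall_sigP _ _ (fun k i => i \notin I1 xbar lbar k ->
    i \notin I2 xbar lbar k -> submxcol l k i 0 = 0)) => // t t1 t2.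
  by rewrite submxcolE sig2K; apply: l_out; rewrite negb_or t1.
(* Disjointness ensures that no multiplier is counted twice when the sum over all constraints is
   split into the two blocks of [v]. *)
have disj i : i \in I1 xbar lbar k -> i \in I2 xbar lbar k = false.
  rewrite !inE => /orP[ie|/andP[l0 _]]; first by rewrite leqNgt ie.
  by rewrite (gt_eqF l0) andbF.
have := congr1 (fun y => submxcol y k) nl.
rewrite submxcol_normals submxcol0 /par_w submxcol0 -/lk => lk_sum.
pose v := row_mx (\row_(a < #|I1 xbar lbar k|) lk (enum_val a) 0)
                 (\row_(a < #|I2 xbar lbar k|) lk (enum_val a) 0).
have v0 : v = 0.
  apply: (row_free_inj (H1 k)); rewrite mul0mx mul_row_col.
  apply/matrixP => o j; rewrite (ord1 o) {o}.
  have sumA (A : {set 'I_(dimu G k)}) :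
      ((\row_(a < #|A|) lk (enum_val a) 0) *m Amat A) 0 j =
      \sum_(i in A) lk i 0 * abar i j 0.
    rewrite mxE [RHS](big_enum_val (fun i => lk i 0 * abar i j 0)).
    by apply: eq_bigr => a _; rewrite mxE [Amat _ _ _]mxE.
  rewrite mxE !sumA [RHS]mxE.
  transitivity (\sum_i (lk i 0 *: avec G k i 0) j 0); last first.
    by have /matrixP/(_ j 0) := lk_sum; rewrite summxE [RHS]mxE.
  rewrite [RHS](bigID (mem (I1 xbar lbar k)))/=; congr (_ + _).
    by apply: eq_bigr => i _; rewrite [RHS]mxE.
  rewrite [RHS](bigID (mem (I2 xbar lbar k)))/= [X in _ = _ + X]big1 ?addr0.
    apply: eq_big => i; last by rewrite [RHS]mxE.
    case: (boolP (i \in I1 xbar lbar k)) => [/disj ->//|//].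
  by move=> i /andP[i1 i2]; rewrite mxE lk_out// mul0r.
apply/matrixP => i o; rewrite (ord1 o) {o} [RHS]mxE -/lk.
have vE1 a : v 0 (lshift _ a) = lk (enum_val a) 0 by rewrite row_mxEl mxE.
have vE2 a : v 0 (rshift _ a) = lk (enum_val a) 0 by rewrite row_mxEr mxE.
have [i1|i1] := boolP (i \in I1 xbar lbar k).
  by rewrite -(enum_rankK_in i1 i1) -vE1 v0 mxE.
have [i2|i2] := boolP (i \in I2 xbar lbar k); last exact: lk_out.
by rewrite -(enum_rankK_in i2 i2) -vE2 v0 mxE.
Qed.

(** The rows of [I1] put [x] into the product of the spaces [Mspace]. Pairing the stationarity row
    with [x] gives the form of [hess 0] as minus the sum of [l t 0 * dotp (normal 0 t) x], whose
    terms are nonnegative on [I2] by sign reversal and zero elsewhere. Hence [x = 0] by [hess0_pos],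
    and then [l = 0] by [normals0_inj]. *)
Lemma loc_matrix0_mixed_P :
  mixed_P (loc_matrix xbar lbar 0) (loc_index xbar lbar).
Proof.
move=> z; rewrite -[z]vsubmxK; move: (usubmx z) (dsubmx z) => {z} x l.
rewrite loc_matrixE => sz.
have row_x : hess 0 *m x + normals 0 *m l = 0.
  apply/matrixP => a o; rewrite (ord1 o) [RHS]mxE.
  by have := sz (lshift m a); rewrite loc_index_lshift col_mxEu.
have row_l t : if in_I2 xbar lbar t then is_true (0 <=
  l t 0 * dotp (normal 0 t) x)
    else if in_I1 xbar lbar t then dotp (normal 0 t) x = 0 else l t 0 = 0.
  have := sz (rshift n t); rewrite loc_index_rshift !col_mxEd mxE /in_I12.
  case: in_I2; first by rewrite orbT mulrN oppr_le0.
  by rewrite orbF; case: in_I1 => // /eqP; rewrite oppr_eq0 => /eqP.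
have x_M k : Mspace xbar lbar k (submxcol x k).
  move=> i; move: k i.
  apply/(@forall_sigP _ _ (fun k i => i \in I1 xbar lbar k ->
    dotp (abar i) (submxcol x k) = 0)) => t t1.
  have := row_l t; rewrite /in_I1 t1 /in_I2 inE /normal dotp_embed /par_w
    submxcol0.
  move: t1; rewrite inE => /orP[te|/andP[l0 _]]; first by rewrite leqNgt te.
  by rewrite (gt_eqF l0) andbF.
have Q_le0 : dotp x (hess 0 *m x) <= 0.
  have := congr1 (dotp x) row_x; rewrite dotpDr dotp0r => /eqP.
  rewrite addr_eq0 => /eqP ->; rewrite oppr_le0 dotp_mulmx dotpE sumr_ge0//
    => t _.
  have -> : ((normals 0)^T *m x) t 0 = dotp (normal 0 t) x.
    by rewrite mxE dotpE; apply: eq_bigr => a _; rewrite !mxE.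
  rewrite mulrC; have := row_l t; case: in_I2 => //.
  by case: in_I1 => ->; rewrite ?mulr0 ?mul0r.
have x0 : x = 0.
  by apply: contra_leP Q_le0 => /eqP xn0; exact: hess0_pos.
rewrite x0 in row_x row_l *; rewrite mulmx0 add0r in row_x.
rewrite (normals0_inj _ row_x) ?col_mx0// => t; rewrite negb_or => /andP[t1 t2].
by have := row_l t; rewrite (negPf t1) (negPf t2).
Qed.

End ReferencePoint.

(** * Local Nash equilibria *)

Section LocalNash.
Import tagnat.
Context {R : realType} {N : nat} (G : quadNEP R N).
Variables (xbar : profile G) (lbar : multipliers G).

Definition own_block (p : parameters G) k := submxblock (Pmat G k (par_w p k))
  k k.

(** At [p = 0] this vanishes exactly on [Mspace]. *)
Definition I1_residual (p : parameters G) k (d : 'cV[R]_(dimx G k)) : R :=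
  \sum_(i in I1 xbar lbar k) `|dotp (avec G k i (par_w p k)) d|.

(** The expansion is exact because the cost is quadratic; stationarity trades its linear term for
    the multipliers. *)
Lemma cost_deviation k (p : parameters G) x (l : 'cV[R]_(dimu G k)) d :
  par_v p k =
    grad (fun y => Lagrangian (deviate x y) l (par_w p k)) (submxcol x k) ->
  cost k p (deviate x (submxcol x k + d)) = cost k p x
    - \sum_i l i 0 * dotp (avec G k i (par_w p k)) d
    + 2^-1 * dotp d (own_block p k *m d).
Proof.
move=> vE; rewrite /cost deviate_embed; set P := Pmat G k _;
  set c := cvec G k _.
rewrite submxcolD submxcol_embed dotp_quadraticD dotpDr dotpDr.
have -> : dotp (par_v p k) d = 2^-1 * dotp ((P + P^T) *m x) (embed d)
    - dotp c (embed d) + \sum_i l i 0 * dotp (avec G k i (par_w p k)) d.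
  rewrite vE grad_Lagrangian dotpDl; congr (_ + _).
    by rewrite dotpC -dotp_embed dotpDr dotpNr dotpZr ![dotp (embed d) _]dotpC.
  rewrite dotpC /dotp mulmx_sumr summxE; apply: eq_bigr => i _.
  by rewrite -scalemxAr mxE -/(dotp _ _) dotpC.
have -> : dotp (embed d) (P *m embed d) = dotp d (own_block p k *m d).
  rewrite dotp_embed submxcol_mulmx (bigD1 k)//= submxcol_embed big1 ?addr0//.
  by move=> i ik; rewrite submxcol_embed_neq// mulmx0.
by ring.
Qed.

Hypotheses (P_C1 : forall k, C1_around (Pmat G k) 0)
  (a_C1 : forall k (i : 'I_(dimu G k)), C1_around (avec G k i) 0)
  (H2 : forall k (y : 'cV[R]_(dimx G k)), y != 0 -> Mspace xbar lbar k y ->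
     0 < dotp y (Pblock G k k k *m y)).

Lemma own_block0 k : own_block 0 k = Pblock G k k k.
Proof. by rewrite /own_block /par_w submxcol0. Qed.

Lemma lip_near_own_block k : lip_near (fun p => own_block p k) 0.
Proof.
apply: lip_near_mx => i j; rewrite /own_block.
rewrite (_ : (fun _ => _) = fun p : parameters G =>
  Pmat G k (par_w p k) (Rank k i) (Rank k j)).
  by apply: lip_near_entry; apply: lip_near_par_w; exact: C1_around_lip_near.
by apply/funext => p; rewrite mxE.
Qed.

(** The curvature plus its absolute value is twice its positive part. Where the residual vanishes,
    [d] lies in [Mspace] and (ii) makes this part positive, so the sum has a positive minimum on the
    sphere. *)
Lemma residual_or_curvature0 k : exists2 c, 0 < c & forall d, `|d| = 1 ->
  c <= I1_residual 0 d + (dotp d (own_block 0 k *m d) + `|dotp d (own_block 0 k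
    *m d)|).
Proof.
apply: sphere_min_gt0 => [|d d_neq0].
  apply: lip_near_continuous => a.
  have idL : lip_near (@id 'cV[R]_(dimx G k)) a by exact: lip_near_id.
  have qL : lip_near (fun d => dotp d (own_block 0 k *m d) : R^o) a.
    by apply: lip_near_dotp => //; apply: lip_near_mulmx => //;
      exact: lip_near_cst.
  apply: lip_nearD; last by apply: lip_nearD => //; exact: lip_near_norm.
  rewrite /I1_residual; under eq_fun do rewrite big_mkcond.
  apply: lip_near_sum => i; case: (i \in _); last exact: lip_near_cst.
  by apply: lip_near_norm; apply: lip_near_dotp => //; exact: lip_near_cst.
have res_ge0 : 0 <= I1_residual 0 d by exact: sumr_ge0.
have q_ge0 : 0 <= dotp d (own_block 0 k *m d) + `|dotp d (own_block 0 k *m d)|.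
  by have [?|?] := ger0P (dotp d (own_block 0 k *m d)); lra.
have [res_le0|] := leP (I1_residual 0 d) 0; last by move: q_ge0; lra.
have dM : Mspace xbar lbar k d.
  move=> i i1; apply/eqP; rewrite -normr_le0; apply: le_trans res_le0.
  rewrite /I1_residual (bigD1 i)//= /par_w submxcol0 lerDl.
  by apply: sumr_ge0.
have := H2 d_neq0 dM; rewrite -own_block0.
by have [?|?] := ger0P (dotp d (own_block 0 k *m d)); lra.
Qed.

Lemma residual_or_curvature k : exists2 c, 0 < c & \forall p \near (0 :
  parameters G),
  forall d, c * `|d| <= I1_residual p d \/ 0 <= dotp d (own_block p k *m d).
Proof.
have [c c_gt0 cP] := residual_or_curvature0 k.
exists (c / 4); first by rewrite divr_gt0.
pose mk := (dimu G k)%:R : R; pose nk := (dimx G k)%:R : R.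
have mk0 : 0 <= mk by []. have nk0 : 0 <= nk by [].
(* Perturbing the normals and the block by at most [e] changes, on unit vectors, the residual by at
   most [mk * nk * e] and the curvature by at most [nk * nk * e]. The summand 1 keeps [K]
   positive. *)
pose K := mk * nk + nk * nk + 1.
have K_gt0 : 0 < K by rewrite ltr_wpDl// addr_ge0// mulr_ge0.
pose e := c / (4 * K).
have e_gt0 : 0 < e by rewrite divr_gt0// mulr_gt0.
have eK : (mk * nk + nk * nk) * e <= c / 4.
  have -> : e = K^-1 * (c / 4) by rewrite /e; field; rewrite lt0r_neq0.
  rewrite mulrA ler_piMl//; first by rewrite divr_ge0// ltW.
  by rewrite ler_pdivrMr// mul1r lerDl.
pose close i (p : parameters G) :=
  `|avec G k i (par_w p k) - avec G k i (par_w 0 k)| < e.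
have a_near i : \forall p \near (0 : parameters G), close i p.
  apply: (@lip_near_dist _ _ _ (fun p => avec G k i (par_w p k))) => //.
  by apply: lip_near_par_w; exact: C1_around_lip_near.
have {}a_near := filter_forall (f := close) (nbhs_filter _) a_near.
have P_near : \forall p \near (0 : parameters G), `|own_block p k - own_block 0
  k| < e.
  by apply: (@lip_near_dist _ _ _ (fun p => own_block p k)) => //;
    exact: lip_near_own_block.
near=> p.
have ap : forall i, close i p by near: p.
have Pp : `|own_block p k - own_block 0 k| < e by near: p.
have unit_case u : `|u| = 1 ->
    c / 4 <= I1_residual p u \/ 0 <= dotp u (own_block p k *m u).
  move=> u1.
  have res_le : I1_residual 0 u <= I1_residual p u + mk * nk * e.
    apply: (@le_trans _ _ (\sum_(i in I1 xbar lbar k)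
      (`|dotp (avec G k i (par_w p k)) u| + nk * e))).
      apply: ler_sum => i _; rewrite -lerBlDl.
      rewrite (le_trans (lerB_dist _ _))// -dotpNl -dotpDl.
      rewrite (le_trans (dotp_bound _ _))// u1 mulr1 ler_wpM2l// distrC.
      exact: ltW (ap i).
    rewrite big_split/= lerD2l sumr_const -mulr_natl -mulrA ler_wpM2r//.
      by rewrite mulr_ge0// ltW.
    by rewrite ler_nat (leq_trans (max_card _))// card_ord.
  have q_le : dotp u (own_block 0 k *m u) <=
      dotp u (own_block p k *m u) + nk * nk * e.
    rewrite -lerBlDl -dotpNr -dotpDr -mulNmx -mulmxDl.
    rewrite (le_trans (ler_norm _))// (le_trans (dotp_bound _ _))// u1 mulr1.
    rewrite -mulrA ler_wpM2l// (le_trans (norm_mulmx _ _))// u1 mulr1.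
    by rewrite ler_wpM2l// distrC ltW.
  have := cP _ u1; have : 0 <= mk * nk * e by rewrite mulr_ge0 ?(ltW e_gt0)//
    mulr_ge0.
  have : 0 <= nk * nk * e by rewrite mulr_ge0 ?(ltW e_gt0)// mulr_ge0.
  rewrite mulrDl in eK; have [?|qp] := leP 0 (dotp u (own_block p k *m u)).
    by right.
  (* Negative curvature at [p] leaves at most [2 * nk * nk * e] for twice the positive part at 0, so
     the residual at [p] is at least [c] minus twice [c / 4]. *)
  move=> e1 e2 c_le; left; move: c_le.
  have [?|?] := ger0P (dotp u (own_block 0 k *m u)); lra.
(* The residual is homogeneous of degree 1 and the curvature of degree 2, so unit vectors
   suffice. *)
move=> d; have [->|d_neq0] := eqVneq d 0.
  by left; rewrite normr0 mulr0; exact: sumr_ge0.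
have d_gt0 : 0 < `|d| by rewrite normr_gt0.
pose u := `|d|^-1 *: d.
have u1 : `|u| = 1 by rewrite normrZ normfV normr_id mulVf// gt_eqF.
have dE : d = `|d| *: u by rewrite scalerA mulfV ?scale1r// gt_eqF.
have [ur|uq] := unit_case u u1.
  left; suff -> : I1_residual p d = `|d| * I1_residual p u.
    by rewrite mulrC ler_wpM2l.
  rewrite /I1_residual mulr_sumr; apply: eq_bigr => i _.
  by rewrite [in LHS]dE dotpZr normrM normr_id.
right; rewrite dE -scalemxAr dotpZl dotpZr.
by rewrite !mulr_ge0.
Unshelve. all: by end_near. Qed.

Lemma pos_lower_bound (I : finType) (A : {set I}) (f : I -> R) :
  (forall i, i \in A -> 0 < f i) ->
  exists2 c, 0 < c & forall i, i \in A -> c <= f i.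
Proof.
(* Starting the minimum at 1 covers an empty [A]. *)
move=> fA; exists (\big[Num.min/1]_(i in A) f i).
  by elim/big_ind: _ => // x y x0 y0; rewrite lt_min x0.
by move=> i iA; exact: bigmin_le_cond.
Qed.

Lemma S_KKT_local_Nash (p : parameters G) x l :
    (forall k, exists2 c, 0 < c & forall d,
       c * `|d| <= I1_residual p d \/ 0 <= dotp d (own_block p k *m d)) ->
    (forall k i, i \in I1 xbar lbar k -> (n_eq G k <= i)%N ->
       0 < submxcol l k i 0) ->
  S_KKT p (x, l) -> local_Nash p x.
Proof.
move=> growth l_pos kkt k; have [/= vE kktk] := kkt k.
have [c c_gt0 cP] := growth k.
have [c' c'_gt0 c'P] : exists2 c', 0 < c' & forall i, i \in I1 xbar lbar k ->
    (n_eq G k <= i)%N -> c' <= submxcol l k i 0.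
  have [i|c' c'0 c'P] := @pos_lower_bound _
      [set i in I1 xbar lbar k | (n_eq G k <= i)%N] (fun i => submxcol l k i 0).
    by rewrite inE => /andP[i1 ie]; exact: l_pos.
  by exists c' => // i i1 ie; apply: c'P; rewrite inE i1.
pose nk := (dimx G k)%:R : R; pose K := nk * (nk * `|own_block p k|) + 1.
have K_gt0 : 0 < K by rewrite ltr_wpDl// !mulr_ge0.
split=> [i|].
  have := kktk i; case: ifP => _; first by lra.
  by move=> [_ + _]; lra.
(* Within this radius the linear gain [c' * c] times the norm of [d] dominates the curvature term,
   which is at most [K] times the squared norm. *)
apply/nbhs_normP; exists (c' * c / K) => /=; first by rewrite !mulr_gt0
  ?invr_gt0.
move=> y /=; have [d ->] : exists d, y = submxcol x k + d.
  by exists (y - submxcol x k); rewrite subrKC.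
rewrite opprD addrA subrr sub0r normrN ltr_pdivlMr// => d_small y_feas.
rewrite deviate_id (cost_deviation d vE).
(* Equalities give a zero product. For an inequality, feasibility of the deviation bounds the
   product by the multiplier times the slack, which is 0; on [I1] the multiplier is at least [c'],
   so the product is at most [- c'] times the absolute value. *)
have term i : submxcol l k i 0 * dotp (avec G k i (par_w p k)) d <=
    if i \in I1 xbar lbar k
    then - (c' * `|dotp (avec G k i (par_w p k)) d|) else 0.
  have := kktk i; have := y_feas i; rewrite dotpDr.
  set g := dotp _ (submxcol x k); set ad := dotp _ d;
    set li := submxcol l k i 0.
  case: ifP => ie.
    move=> y_eq x_eq; have -> : ad = 0 by lra.
    by rewrite normr0 !mulr0 oppr0 if_same.
  move=> y_le [l0 gu lg].
  have lad : li * ad <= 0.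
    have : li * ad <= li * (par_u p k i 0 - (g - bvec G k i 0)).
      by rewrite ler_wpM2l//; lra.
    lra.
  case: ifP => // i1; have li_ge : c' <= li by rewrite c'P// leqNgt ie.
  have ad_le0 : ad <= 0.
    by rewrite -(pmulr_rle0 _ (lt_le_trans c'_gt0 li_ge)).
  rewrite ler0_norm// mulrN opprK.
  by rewrite -subr_ge0 -mulrBl mulr_le0// subr_le0.
have sum_le : \sum_i submxcol l k i 0 * dotp (avec G k i (par_w p k)) d <=
    - (c' * I1_residual p d).
  rewrite (le_trans (ler_sum _ (fun i _ => term i)))// -big_mkcond/=.
  by rewrite sumrN -mulr_sumr.
have res_ge0 : 0 <= c' * I1_residual p d.
  by rewrite mulr_ge0 ?(ltW c'_gt0)// sumr_ge0.
have [res|curv] := cP d; last by lra.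
have : c' * (c * `|d|) <= c' * I1_residual p d by rewrite ler_wpM2l// ltW.
have : `|dotp d (own_block p k *m d)| <= `|d| * K * `|d|.
  rewrite (le_trans (dotp_bound _ _))//.
  apply: (@le_trans _ _ (nk * `|d| * (nk * `|own_block p k| * `|d|))).
    by rewrite ler_wpM2l ?mulr_ge0// norm_mulmx.
  rewrite mulrA ler_wpM2r// /K mulrDr mulr1 -[leLHS]addr0 lerD//.
  by rewrite [nk * `|d|]mulrC -!mulrA.
have : `|d| * K * `|d| <= c' * c * `|d| by rewrite ler_wpM2r// ltW.
have := ler_norm (- dotp d (own_block p k *m d)); rewrite normrN.
have : 0 <= c' * c * `|d| by rewrite mulr_ge0// mulr_ge0// ltW.
lra.
Qed.

End LocalNash.

Theorem proposition6p1 (R : realType) (N : nat) (G : quadNEP R N)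
    (n_eq_le : forall k, (n_eq G k <= dimu G k)%N)
    (P_C1 : forall k, C1_around (Pmat G k) 0)
    (c_C1 : forall k, C1_around (cvec G k) 0)
    (a_C1 : forall k (i : 'I_(dimu G k)), C1_around (avec G k i) 0)
    (P_sym : forall k, (Pmat G k 0)^T = Pmat G k 0)
    (xbar : profile G) (lbar : multipliers G)
    (KKTbar : S_KKT (0 : parameters G) (xbar, lbar))
    (r : 'I_N -> nat) (B : forall k, 'M[R]_(dimx G k, r k))
    (B_basis : forall k, is_col_basis (B k) (Mspace xbar lbar k))
    (H1 : forall k, row_free (col_mx (Amat (I1 xbar lbar k))
                                     (Amat (I2 xbar lbar k))))
    (H2 : forall k (y : 'cV[R]_(dimx G k)), y != 0 -> Mspace xbar lbar k y ->
       0 < dotp y (Pblock G k k k *m y))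
    (H3 : exists alpha : 'I_N -> 'I_N -> R,
       [/\ forall i j, j != i -> 0 < alpha i j,
           forall i, \sum_(j | j != i) alpha i j = 1 &
           forall i k, i != k ->
           forall y : 'cV[R]_(dimx G k), y != 0 -> Mspace xbar lbar k y ->
             0 < dotp y ((Pblock G k k k
               - (4 * alpha i k * alpha k i)^-1 *:
                 ((Tmat G i k)^T *m B i
                  *m invmx ((B i)^T *m Pblock G i i i *m B i)
                  *m (B i)^T *m Tmat G i k)) *m y)]) :
  lipschitz_localization (@S_KKT R N G) 0 (xbar, lbar) /\
  \forall z \near ((0 : parameters G), (xbar, lbar)),
    S_KKT z.1 z.2 -> local_Nash z.1 z.2.1.
Proof.
have KKT_flat : flat_KKT 0 xbar lbar by apply/S_KKT_flat.
have signs := same_signs_near xbar lbar a_C1.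
split.
  split=> //.
  have [] := @mlcp_strong_regularity _ _ _ (loc_matrix xbar lbar)
    (loc_vector xbar lbar) (loc_index xbar lbar) 0 (col_mx xbar lbar).
  - exact (loc_matrix0_mixed_P P_sym B_basis H2 H3 H1).
  - exact: lip_near_loc_matrix.
  - exact: lip_near_loc_vector.
  - by apply/mlcp_loc_KKT; apply/flat_KKT_loc.
  move=> f [f_lip f_sol].
  pose split_col (z : 'cV[R]_(_ + _)) : profile G * multipliers G :=
    (usubmx z, dsubmx z).
  pose g p := split_col (f p).
  have g_lip : lip_near g 0.
    apply: (lip_near_comp (f := split_col) f_lip);
      apply: lip_near_nonexp => x y.
    rewrite prod_normE ge_max; apply/andP; split; apply/ler_mx_normP => // i j.
      by have := ler_mx_entry (x - y) (lshift _ i) j; rewrite !mxE.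
    by have := ler_mx_entry (x - y) (rshift _ i) j; rewrite !mxE.
  (* On the product neighbourhood [U1] times [W] signs are preserved, so the KKT system coincides
     there with the complementarity problem. *)
  have [[U1 W] [/= nU1 nW] signsP] := signs.
  have locP p x l : U1 p -> W (x, l) -> S_KKT p (x, l) <->
      mlcp (loc_matrix xbar lbar p) (loc_vector xbar lbar p)
        (loc_index xbar lbar) (col_mx x l).
    move=> U1p Wxl; rewrite S_KKT_flat mlcp_loc_KKT; apply: flat_KKT_loc => //.
    exact: (signsP (p, (x, l)) (conj U1p Wxl)).
  have g0 : g 0 = (xbar, lbar).
    rewrite /g -((nbhs_singleton f_sol (col_mx xbar lbar)).1 _).
      by rewrite /split_col col_mxKu col_mxKd.
    by apply/locP => //; exact: nbhs_singleton.
  (* Restricting to parameters with [g p] in [W] makes [g] map [U] into [W], as the equality of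
     graphs demands. *)
  have nWg : \forall p \near (0 : parameters G), W (g p).
    have [e/= e_gt0 eW] := (nbhs_normP _ _).1 nW.
    near=> p; apply: eW => /=; rewrite -g0 distrC.
    by near: p; exact: lip_near_dist g_lip _.
  have [C [U2 [C_ge0 nU2 gC]]] := g_lip.
  pose U := [set p | [/\ U1 p, U2 p, W (g p) & forall z,
    mlcp (loc_matrix xbar lbar p) (loc_vector xbar lbar p) (loc_index xbar
      lbar) z
    <-> z = f p]].
  have nU : nbhs (0 : parameters G) U.
    by near=> p; split; near: p.
  exists U, W; split=> //; exists g; split.
    apply: (@klipschitzW _ _ _ C).
      (* The set of pairs from [U] is nonempty, witnessed by [(0, 0)]. *)
      exact: (@globally_properfilter _ _ (0, 0)) (conj (nbhs_singleton nU)
        (nbhs_singleton nU)).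
    by move=> [p q] [/= [_ Up _ _] [_ Uq _ _]]; exact: gC.
  apply/seteqP; split=> -[p [x l]] /=.
    move=> [kkt [Up Wxl]]; split=> //; case: Up => U1p _ _ fP.
    move: kkt => /(locP _ _ _ U1p Wxl)/fP fE.
    by rewrite /g /split_col -fE col_mxKu col_mxKd.
  move=> [Up ->]; case: (Up) => U1p _ Wg fP; split=> //.
  by apply/locP => //; apply/fP; rewrite /g /= vsubmxK.
pose growth k (p : parameters G) := exists2 c, 0 < c & forall d,
  c * `|d| <= I1_residual xbar lbar p d \/ 0 <= dotp d (own_block p k *m d).
have nU k : \forall p \near (0 : parameters G), growth k p.
  have [c c_gt0 cP] := residual_or_curvature P_C1 a_C1 H2 k.
  by apply: filterS cP => p dP; exists c.
have {}nU := filter_forall (f := growth) (nbhs_filter _) nU.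
have nU' : \forall z \near ((0 : parameters G), (xbar, lbar)), forall k, growth
  k z.1.
  by exists ([set p | forall k, growth k p], setT) => /= [|z []//];
    split=> //; exact: filterT.
apply: filterS2 nU' signs => -[p [x l]] /= gr sg kkt.
(* It remains to see that the inequality multipliers in [I1] are positive: those of [lbar] are, and
   [same_signs] transfers this to [l]. *)
apply: S_KKT_local_Nash gr _ kkt => k i; move: k i.
apply/(@forall_sigP _ _ (fun k i => i \in I1 xbar lbar k -> (n_eq G k <= i)%N ->
  0 < submxcol l k i 0)) => t t1 te.
have [+ _] := sg t; rewrite submxcolE tagnat.sig2K /is_eq -leqNgt te =>
  /(_ isT); apply.
move: t1; rewrite -[_ \in _]/(in_I1 xbar lbar t) in_I1E /is_eq ltnNge te /=.
by case/andP.
Unshelve. all: by end_near. Qed.
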